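(* Assume (A1)–(A5) hold; $p:\mathbb{R}\times X\to X$ satisfies $\|p(t,u)-p(s,v)\|\le L_p(|s-t|+\|u-v\|)$ for some $L_p\ge0$ and $\|p(s,u)\|\le C_1\|u\|+C_2$ for some $C_1,C_2\ge0$ and all arguments; and $G:\mathbb{R}\times X\times X\to X$ is continuous and locally Lipschitz in its second and third arguments, i.e. for every $R>0$ there is $L_{G,R}>0$ with $\|G(t,u^1,v^1)-G(t,u^2,v^2)\|\le L_{G,R}(\|u^1-u^2\|+\|v^1-v^2\|)$ for all $t>a$ and $\|u^i\|,\|v^i\|\le R$. Then for every $\varphi\in C$ the problem $\frac{du}{dt}+Au=B(t,u_t)$, $t\ge a$, $u_a=\varphi$, possesses a unique mild solution on an interval of the form $[a,b)$ with $a<b\le+\infty$. The solution depends continuously on the initial data: if $\varphi^n,\varphi\in C$ and $\|\varphi^n-\varphi\|_C\to0$, then $\|u^n_t-u_t\|_C\to0$ for every $t\in[a,b)$, where $u^n$ is the unique mild solution with initial function $\varphi^n$ and $u$ the one with initial function $\varphi$.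
   Context: Let $X$ be a Banach space with norm $\|\cdot\|$, $r>0$, $a\in\mathbb{R}$, and $C=C([-r,0];X)$ with the supremum norm $\|\cdot\|_C$. For a continuous $u$ on $[a-r,b)$ and $t\in[a,b)$, $u_t(\theta)=u(t+\theta)$, $\theta\in[-r,0]$. Let $A$ be the infinitesimal generator of a compact $C_0$-semigroup $\{e^{-At}\}_{t\ge0}$ on $X$ with $\|e^{-At}\|\le e^{\omega t}$, $t\ge0$, for a fixed $\omega\in\mathbb{R}$. The nonlinearity is $B(t,\psi)=G(t,\psi(0),F(t,\psi))$ with $F(t,\psi)=\int_{-r}^0p(t,\psi(\theta))\,dg(\theta,t,\psi)$ (Stieltjes integral in $\theta$), $g:[-r,0]\times\mathbb{R}\times C\to\mathbb{R}$. (A1): for every $(t,\varphi)$, $g(\cdot,t,\varphi)$ has bounded variation on $[-r,0]$ with $V_{-r}^0g(\cdot,t,\varphi)\le M_{Vg}$, a constant independent of $(t,\varphi)$. Write $g=g_d+g_c$, $g_d(\cdot,t,\varphi)$ the jump (step-function) part and $g_c=g_{ac}+g_s$ the continuous part (absolutely continuous plus singular continuous) of $g(\cdot,t,\varphi)$. (A2): for each $\theta$, $(t,\varphi)\mapsto g_c(\theta,t,\varphi)$ is continuous on $\mathbb{R}\times C$. (A3): the jump points of $g_d(\cdot,t,\varphi)$ are $\theta_k=-\eta_k(t,\varphi)$ with jumps $h_k(t,\varphi)=g_d(\theta_k+0,t,\varphi)-g_d(\theta_k-0,t,\varphi)$, where $\eta_k:\mathbb{R}\times C\to[0,r]$ and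 $h_k:\mathbb{R}\times C\to\mathbb{R}$ are continuous, and $\sum_kh_k(t,\varphi)$ converges absolutely and uniformly on bounded subsets of $\mathbb{R}\times C$. (A4): there is $L_{Vg_c}\ge0$ such that for all $t^1,t^2\ge a$ and $\varphi,\psi\in C$, the total variation on $[-r,0]$ of $\theta\mapsto g_c(\theta,t^1,\varphi)-g_c(\theta,t^2,\psi)$ is at most $L_{Vg_c}(|t^1-t^2|+\|\varphi-\psi\|_C)$. (A5): there is a continuous function $\eta_{ign}:[a,\infty)\to(0,\infty)$ such that for all $t\ge a$ and all $\varphi^1,\varphi^2\in C$ with $\varphi^1(\theta)=\varphi^2(\theta)$ for all $\theta\in[-r,-\eta_{ign}(t)]$, one has $\eta_k(t,\varphi^1)=\eta_k(t,\varphi^2)$ and $h_k(t,\varphi^1)=h_k(t,\varphi^2)$ for all $k$. A mild solution on $[a-r,T]$ is $u\in C([a-r,T];X)$ with $u_a=\varphi$ and $u(t)=e^{-A(t-a)}\varphi(0)+\int_a^te^{-A(t-s)}B(s,u_s)\,ds$ for $t\in[a,T]$; a mild solution on $[a,b)$ is a function on $[a-r,b)$ that is a mild solution on $[a-r,T]$ for every $T\in[a,b)$. *)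

(* Defs.v *)
From HB Require Import structures.
From mathcomp Require Import all_boot all_order all_algebra.
From mathcomp Require Import all_classical all_reals all_analysis.
Set Implicit Arguments. Unset Strict Implicit. Unset Printing Implicit Defensive.
Import Order.TTheory GRing.Theory Num.Theory.
Import numFieldNormedType.Exports.
Local Open Scope classical_set_scope.
Local Open Scope ring_scope.

Section Defs.
Context {R : realType} {X : completeNormedModType R}.

(* The space C = C([-r,0];X): functions R -> X continuous on [-r,0]
   (values outside [-r,0] are irrelevant). *)
Definition inC (r : R) (phi : R -> X) : Prop :=
  {within `[-r, 0], continuous phi}.

Definition supnorm (r : R) (phi : R -> X) : R :=
  sup [set `|phi th| | th in `[-r, 0]].

(* the segment u_t(theta) = u(t+theta), theta in [-r,0]; outside [-r,0]
   it is extended constantly (clamping), so that u_t only depends on the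
   values of u on [t-r,t]. *)
Definition seg (r : R) (u : R -> X) (t : R) : R -> X :=
  fun th => u (t + Num.min 0 (Num.max (- r) th)).

(* Riemann-Stieltjes integral of f : R -> X w.r.t. g : R -> R on [lo,hi]:
   limit of Riemann-Stieltjes sums as the mesh of the tagged partition -> 0.
   With g = id this is the (Riemann) integral of a continuous X-valued map. *)
Definition is_RSint (f : R -> X) (g : R -> R) (lo hi : R) (I : X) : Prop :=
  forall eps : R, 0 < eps -> exists2 delta : R, 0 < delta &
    forall (n : nat) (x xi : nat -> R),
      x 0%N = lo -> x n = hi ->
      (forall i, (i < n)%N -> x i <= xi i <= x i.+1) ->
      (forall i, (i < n)%N -> x i.+1 - x i < delta) ->
      `| \sum_(i < n) ((g (x i.+1) - g (x i)) *: f (xi i)) - I | < eps.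

Definition RSint (f : R -> X) (g : R -> R) (lo hi : R) : X :=
  xget 0 [set I | is_RSint f g lo hi I].

Definition rsum (u : nat -> R) : R := limn (fun n => \sum_(i < n) u i).

Definition contRC (r : R) (f : R -> (R -> X) -> R) : Prop :=
  forall t phi, inC r phi -> forall eps : R, 0 < eps -> exists2 delta : R, 0 < delta &
    forall s psi, inC r psi -> `|s - t| < delta -> supnorm r (psi \- phi) < delta ->
      `|f s psi - f t phi| < eps.

(* gd is the jump (saltus) part of a function on [-r,0] with jump points
   theta_k = - eta k and jumps h k (multiplicities allowed), normalised by
   gd(-r) = 0.  For x <= y, where x is -r or not a jump point, and y is 0
   or not a jump point, gd y - gd x is the sum of the jumps located in
   the interval (x,y), where the endpoint -r (resp. 0) is included when
   x = -r (resp. y = 0); one-sided jumps at -r and 0 use the conventions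
   gd(-r-0) := gd(-r), gd(0+0) := gd(0). *)
Definition is_jump_part (r : R) (gd : R -> R) (eta h : nat -> R) : Prop :=
  gd (- r) = 0 /\
  forall x y, - r <= x -> x <= y -> y <= 0 ->
    (x = - r \/ forall k, - eta k != x) ->
    (y = 0 \/ forall k, - eta k != y) ->
    gd y - gd x =
      rsum (fun k => if ((x < - eta k) || (x == - r))
                        && ((- eta k < y) || (y == 0))
                     then h k else 0).

Definition mild_on (r a T : R) (S : R -> X -> X) (B : R -> (R -> X) -> X)
    (phi : R -> X) (u : R -> X) : Prop :=
  {within `[a - r, T], continuous u} /\
  (forall th, - r <= th <= 0 -> u (a + th) = phi th) /\
  (forall t, a <= t <= T ->
     is_RSint (fun s => S (t - s) (B s (seg r u s))) id a t
              (u t - S (t - a) (phi 0))).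

Definition mild_on_ab (r a : R) (b : \bar R) (S : R -> X -> X)
    (B : R -> (R -> X) -> X) (phi : R -> X) (u : R -> X) : Prop :=
  forall T, a <= T -> (T%:E < b)%E -> mild_on r a T S B phi u.

End Defs.

(* Main.v *)
Require Import Defs.
From HB Require Import structures.
From mathcomp Require Import all_boot all_order all_algebra.
From mathcomp Require Import all_classical all_reals all_analysis.
From mathcomp Require Import ring lra.
Import Order.TTheory GRing.Theory Num.Theory.
Import numFieldNormedType.Exports.
Local Open Scope classical_set_scope.
Local Open Scope ring_scope.
Set Implicit Arguments. Unset Strict Implicit. Unset Printing Implicit Defensive.

(* Two states sharing the history that (A5) allows the jumps to see have the same
   jump part, so on partitions avoiding the jump points the delay integrals differ
   only through the integrand and, by (A4), through the continuous part of the
   integrator: the nonlinearity is Lipschitz between such states, and jointly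
   continuous in general by uniform convergence of the series of jumps.  As
   [eta_ign] stays above [t - a] on a short interval [a, a + sig0], all candidate
   solutions with a given initial function share that history.  A contraction
   argument gives existence up to [a + sig], with [sig] depending only on a bound
   for the initial function.  Continuous dependence, hence uniqueness, follows from
   Gronwall's inequality after replacing the history of the reference solution by
   the perturbed one.  The lifetime [b phi] depends on the integer part of the norm
   of [phi] only and is nonincreasing in it, hence lower semicontinuous. *)

(** * Continuous functions on a segment *)

(** The obstacle is the term [psi (- eta k t psi)]: when [psi] is merely continuous, it need not be
    Lipschitz in [psi], because the evaluation point moves with the state. Freezing [eta k] and
    [h k] removes this motion, but two different initial functions need not share any history. The
    comparison state is at a small uniform distance from the reference solution, where plain
    continuity of [B], uniform along the compact curve of segments, is enough: its error enters
    Gronwall's inequality as an additive constant. Jump points have to be avoided because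
    [is_jump_part] prescribes no increment of [gd] having an interior endpoint at a jump. Integral
    estimates never leave Riemann sums: a bound is obtained by exhibiting a real function whose
    increments dominate the summands. *)

Definition cont_on (R : realType) (V : normedModType R) (lo hi : R)
    (f : R -> V) : Prop :=
  forall x, lo <= x <= hi -> forall e : R, 0 < e -> exists2 d : R, 0 < d &
    forall y, lo <= y <= hi -> `|y - x| < d -> `|f y - f x| < e.

Lemma within_continuousP (R : realType) (V : normedModType R) (A : set R)
    (f : R -> V) :
  {within A, continuous f} <->
  (forall x, A x -> forall e, 0 < e -> exists2 d, 0 < d &
    forall y, A y -> `|y - x| < d -> `|f y - f x| < e).
Proof.
rewrite subspace_continuousP; split=> H x Ax.
  move=> e e0; have /cvgrPdist_lt/(_ e e0) := H x Ax.
  move=> /nbhs_ballP[d /= d0 Hd]; exists d => // y Ay yx.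
  rewrite distrC; apply: Hd => //.
  by rewrite /ball/= distrC.
apply/cvgrPdist_lt => e e0; have [d d0 Hd] := H x Ax e e0.
apply/nbhs_ballP; exists d => // y; rewrite /ball/= => yx Ay.
by rewrite distrC; apply: Hd => //; rewrite distrC.
Qed.

Lemma cont_onP (R : realType) (V : normedModType R) lo hi (f : R -> V) :
  {within `[lo, hi], continuous f} <-> cont_on lo hi f.
Proof.
rewrite within_continuousP; split=> H x Ax e e0.
  have [|d d0 Hd] := H x _ e e0; first by rewrite /= in_itv.
  by exists d => // y Ay; apply: Hd; rewrite /= in_itv.
move: Ax; rewrite /= in_itv/= => Ax.
have [d d0 Hd] := H x Ax e e0.
by exists d => // y; rewrite /= in_itv/=; exact: Hd.
Qed.

(* A Lebesgue-number principle: a local scale can be chosen uniformly. *)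
Lemma itv_uniform (R : realType) (lo hi : R) (P : R -> R -> Prop) :
  (forall x, lo <= x <= hi -> exists2 d, 0 < d &
     forall y, lo <= y <= hi -> `|y - x| < d ->
     forall e, 0 < e -> e < d -> P e y) ->
  exists2 d, 0 < d & forall y, lo <= y <= hi -> P d y.
Proof.
move=> H.
have /compact_near_coveringP cov := @segment_compact R lo hi.
have := cov _ (0^'+) (fun e y => lo <= y <= hi -> P e y) _.
move=> /(_ _)[].
  move=> x /=; rewrite in_itv/= => Ax.
  have [d d0 Hd] := H x Ax.
  exists ([set y | `|y - x| < d], [set e | 0 < e < d]) => /=.
    split; first by apply/nbhs_ballP; exists d => // y; rewrite /ball/= distrC.
    by near=> e; apply/andP; split; near: e; [exact: nbhs_right_gt|exact: nbhs_right_lt].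
  by move=> [y e] /= [xy /andP[e0 ed]] Ay; exact: Hd.
move=> d /= d0 Hd.
exists (d / 2); first by rewrite divr_gt0.
move=> y Ay; apply: (Hd (d/2)) => //=.
- rewrite sub0r normrN gtr0_norm ?divr_gt0// ltr_pdivrMr//.
  by rewrite mulr_natr mulr2n ltrDr.
- by rewrite divr_gt0.
Unshelve. all: by end_near.
Qed.

Section ContOn.
Context {R : realType} {V : normedModType R}.
Implicit Types (lo hi : R) (f g : R -> V).

Lemma cont_on_uniform lo hi f : cont_on lo hi f ->
  forall e, 0 < e -> exists2 d, 0 < d & forall x y, lo <= x <= hi ->
    lo <= y <= hi -> `|x - y| < d -> `|f x - f y| < e.
Proof.
move=> cf e e0.
have [|d d0 Hd] := @itv_uniform R lo hi (fun d x => forall y, lo <= y <= hi ->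
    `|x - y| < d -> `|f x - f y| < e); last by exists d => // x y Ax Ay; exact: Hd.
move=> x Ax; have e20 : 0 < e / 2 by rewrite divr_gt0.
have [d d0 Hd] := cf x Ax _ e20.
exists (d / 2); first by rewrite divr_gt0.
move=> y Ay yx k k0 kd z Az yz.
have h1 : `|f y - f x| < e / 2 by apply: Hd => //; lra.
have h2 : `|f x - f z| < e / 2.
  rewrite distrC; apply: Hd => //.
  rewrite distrC in yz; have := ler_distD y z x; lra.
have := ler_distD (f x) (f y) (f z); lra.
Qed.

Lemma cont_on_bounded lo hi f : cont_on lo hi f ->
  exists2 K, 0 < K & forall x, lo <= x <= hi -> `|f x| <= K.
Proof.
move=> cf.
(* The bound is encoded as the inverse of a scale, so that a uniform scale is a uniform bound. *)
have [|d d0 Hd] := @itv_uniform R lo hi (fun d x => `|f x| <= d^-1).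
  move=> x Ax; have [d d0 Hd] := cf x Ax 1 ltr01.
  have n0 : 0 < `|f x| + 1 by rewrite ltr_wpDl.
  exists (Num.min d (`|f x| + 1)^-1); first by rewrite lt_min d0 invr_gt0.
  move=> y Ay; rewrite lt_min => /andP[yd _] e e0; rewrite lt_min => /andP[_ eK].
  have h1 := Hd y Ay yd.
  have h2 : `|f x| + 1 < e^-1 by rewrite -[ltLHS]invrK ltf_pV2// posrE invr_gt0.
  have := ler_distD (f x) (f y) 0; rewrite !subr0; lra.
by exists d^-1 => //; rewrite invr_gt0.
Qed.

Lemma cont_on_sub lo hi lo' hi' f : lo <= lo' -> hi' <= hi ->
  cont_on lo hi f -> cont_on lo' hi' f.
Proof.
move=> l h cf x /andP[x1 x2] e e0.
have [|d d0 Hd] := cf x _ e e0; first by lra.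
by exists d => // y /andP[y1 y2]; apply: Hd; lra.
Qed.

Lemma cont_onD lo hi f g : cont_on lo hi f -> cont_on lo hi g ->
  cont_on lo hi (fun x => f x + g x).
Proof.
move=> cf cg x Ax e e0; have e20 : 0 < e / 2 by rewrite divr_gt0.
have [d1 d10 H1] := cf x Ax _ e20; have [d2 d20 H2] := cg x Ax _ e20.
exists (Num.min d1 d2); first by rewrite lt_min d10.
move=> y Ay; rewrite lt_min => /andP[y1 y2].
rewrite opprD addrACA (le_lt_trans (ler_normD _ _))//.
have := H1 y Ay y1; have := H2 y Ay y2; lra.
Qed.

Lemma cont_onN lo hi f : cont_on lo hi f -> cont_on lo hi (fun x => - f x).
Proof.
move=> cf x Ax e e0; have [d d0 Hd] := cf x Ax e e0.
by exists d => // y Ay yx; rewrite -opprD normrN; exact: Hd.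
Qed.

Lemma cont_onB lo hi f g : cont_on lo hi f -> cont_on lo hi g ->
  cont_on lo hi (fun x => f x - g x).
Proof. by move=> cf cg; apply: cont_onD => //; exact: cont_onN. Qed.

Lemma cont_on_cst lo hi (c : V) : cont_on lo hi (fun _ => c).
Proof. by move=> x _ e e0; exists 1 => // y _ _; rewrite subrr normr0. Qed.

Lemma cont_on_comp lo hi lo' hi' (k : R -> R) f :
  (forall x, lo' <= x <= hi' -> lo <= k x <= hi) ->
  (forall x y, `|k x - k y| <= `|x - y|) ->
  cont_on lo hi f -> cont_on lo' hi' (fun x => f (k x)).
Proof.
move=> km kl cf x Ax e e0; have [d d0 Hd] := cf _ (km _ Ax) e e0.
exists d => // y Ay yx; apply: Hd; first exact: km.
exact: le_lt_trans (kl _ _) yx.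
Qed.

Lemma cont_on_unif_limit lo hi f :
  (forall e, 0 < e -> exists2 g, cont_on lo hi g &
     forall x, lo <= x <= hi -> `|g x - f x| < e) ->
  cont_on lo hi f.
Proof.
move=> H x Ax e e0; have e30 : 0 < e / 3 by rewrite divr_gt0.
have [g cg gf] := H _ e30; have [d d0 Hd] := cg x Ax _ e30.
exists d => // y Ay yx.
have := gf x Ax; have := gf y Ay; have := Hd y Ay yx; rewrite (distrC _ (f y)).
have := ler_distD (g y) (f y) (f x); have := ler_distD (g x) (g y) (f x).
lra.
Qed.

End ContOn.

Lemma cauchy_limit (R : realType) (X : completeNormedModType R) (u : nat -> X) :
  (forall e, 0 < e -> exists N, forall n m, (N <= n)%N -> (N <= m)%N ->
     `|u n - u m| < e) ->
  exists l, forall e, 0 < e -> exists N, forall n, (N <= n)%N -> `|u n - l| < e.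
Proof.
move=> H.
have /cvg_ex[l ul] : cvg (u @ \oo).
  apply/cauchy_cvgP/cauchy_exP => e e0.
  have [N HN] := H e e0; exists (u N).
  exists N => // n /= Nn; by rewrite -ball_normE/=; exact: HN.
exists l => e e0; move/cvgrPdist_lt: ul => /(_ e e0)[N _ HN].
by exists N => n Nn; rewrite distrC; exact: HN.
Qed.

Lemma mul_half_iter_small (R : realType) (D e : R) : 0 < e ->
  exists N, forall n, (N <= n)%N -> D * (2^-1) ^+ n < e.
Proof.
move=> e0.
have : (fun n => D * (2^-1) ^+ n) @ \oo --> (D * 0 : R).
  apply: cvgMr; apply: cvg_expr; rewrite ger0_norm ?invr_ge0//.
  by rewrite invf_lt1// ltr1n.
rewrite mulr0 => /cvgrPdist_lt/(_ e e0)[N _ HN].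
exists N => n /HN/=; rewrite sub0r normrN => /(le_lt_trans _); apply.
exact: ler_norm.
Qed.

(** * Riemann-Stieltjes integrals *)

Lemma telescope_ord (V : zmodType) (F : nat -> V) n :
  \sum_(i < n) (F i.+1 - F i) = F n - F 0%N.
Proof.
elim: n => [|n IHn]; first by rewrite big_ord0 subrr.
by rewrite big_ord_recr/= IHn addrC addrA subrK.
Qed.

(** * Truncation to a segment *)

Section Clamp.
Context {R : realType}.
Implicit Types lo hi x y : R.

(** Serves to cut the cells of a partition, to read [seg], and to extend functions by their end
    values. *)
Definition clamp lo hi x : R := Num.min hi (Num.max lo x).

Lemma clamp_in lo hi x : lo <= hi -> lo <= clamp lo hi x <= hi.
Proof.
move=> lohi; rewrite /clamp.
by case: (leP lo x) => h1; case: (leP hi _) => h2; lra.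
Qed.

Lemma clamp_id lo hi x : lo <= x <= hi -> clamp lo hi x = x.
Proof.
rewrite /clamp => /andP[a b].
by case: (leP lo x) => h1; case: (leP hi _) => h2; lra.
Qed.

Lemma clamp_lo lo hi x : lo <= hi -> x <= lo -> clamp lo hi x = lo.
Proof.
rewrite /clamp => a b.
by case: (leP lo x) => h1; case: (leP hi _) => h2; lra.
Qed.

Lemma clamp_hi lo hi x : lo <= hi -> hi <= x -> clamp lo hi x = hi.
Proof.
rewrite /clamp => a b.
by case: (leP lo x) => h1; case: (leP hi _) => h2; lra.
Qed.

Lemma clamp_lip lo hi x y : `|clamp lo hi x - clamp lo hi y| <= `|x - y|.
Proof.
have xy := ler_norm (x - y); have yx := ler_norm (y - x).
rewrite distrC in yx; rewrite ler_norml /clamp.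
by case: (leP lo x) => h1; case: (leP lo y) => h2;
  case: (leP hi x) => h3; case: (leP hi y) => h4; case: (leP hi lo) => h5; lra.
Qed.

Lemma clamp_mono lo hi x y : x <= y -> clamp lo hi x <= clamp lo hi y.
Proof.
move=> xy; rewrite /clamp.
by case: (leP lo x) => h1; case: (leP lo y) => h2;
  case: (leP hi x) => h3; case: (leP hi y) => h4; case: (leP hi lo) => h5; lra.
Qed.

End Clamp.

Section Control.
Context {R : realType}.

(* [v] plays the role of the variation function of [g]. *)
Definition controls (v g : R -> R) lo hi :=
  forall x y, lo <= x -> x <= y -> y <= hi -> `|g y - g x| <= v y - v x.

Lemma controls_id lo hi : controls id id lo hi.
Proof. by move=> x y _ xy _; rewrite ger0_norm// subr_ge0. Qed.

(** The variation function [total_variation lo x g] works: additivity over adjacent segments gives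
    the increments, and finiteness passes from the whole segment to its parts. *)
Lemma controls_total_variation (g : R -> R) lo hi V : lo <= hi ->
  (total_variation lo hi g <= V%:E)%E ->
  exists2 v, controls v g lo hi & v hi - v lo <= V.
Proof.
move=> lohi tv.
have fin x y : lo <= x -> x <= y -> y <= hi -> total_variation x y g \is a fin_num.
  move=> lx xy yh; rewrite ge0_fin_numE ?total_variation_ge0//.
  apply: le_lt_trans (ltry V); apply: le_trans tv.
  rewrite (total_variationD g (le_trans lx xy) yh).
  rewrite (total_variationD g lx xy).
  have h1 := total_variation_ge0 g lx; have h2 := total_variation_ge0 g yh.
  apply: (@le_trans _ _ (total_variation lo x g + total_variation x y g)%E).
    by rewrite leeDr.
  by rewrite leeDl.
exists (fun x => fine (total_variation lo x g)).
  move=> x y lx xy yh.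
  have h := total_variation_ge g xy.
  rewrite (total_variationD g lx xy) fineD; [|exact: fin (le_trans xy yh)|exact: fin].
  rewrite addrAC subrr add0r -lee_fin fineK//; exact: fin.
by rewrite total_variationxx/= subr0 -lee_fin fineK//; exact: fin.
Qed.

End Control.

Section RSIntegral.
Context {R : realType} {X : completeNormedModType R}.
Implicit Types (f : R -> X) (g v : R -> R) (lo hi : R).

Definition tpart n (x xi : nat -> R) lo hi d :=
  [/\ x 0%N = lo, x n = hi,
      forall i, (i < n)%N -> x i <= xi i <= x i.+1 &
      forall i, (i < n)%N -> x i.+1 - x i < d].

Definition RSsum f g n (x xi : nat -> R) : X :=
  \sum_(i < n) ((g (x i.+1) - g (x i)) *: f (xi i)).

Lemma partition_mono n (x : nat -> R) i j :
  (forall i, (i < n)%N -> x i <= x i.+1) -> (i <= j)%N -> (j <= n)%N -> x i <= x j.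
Proof.
move=> xm; elim: j => [|j IHj]; first by rewrite leqn0 => /eqP->.
rewrite leq_eqVlt => /predU1P[->//|ij] jn.
by apply: le_trans (xm _ jn); apply: IHj => //; exact: ltnW.
Qed.

Lemma tpart_mono n x xi lo hi d i : tpart n x xi lo hi d -> (i < n)%N ->
  x i <= x i.+1.
Proof. by case=> _ _ h _ /h/andP[]; exact: le_trans. Qed.

Lemma tpart_lo n x xi lo hi d i : tpart n x xi lo hi d -> (i <= n)%N -> lo <= x i.
Proof.
move=> tg; have [<- _ _ _] := tg; apply: (@partition_mono n) => // k.
exact: tpart_mono tg.
Qed.

Lemma tpart_hi n x xi lo hi d i : tpart n x xi lo hi d -> (i <= n)%N -> x i <= hi.
Proof.
move=> tg iN; have [_ <- _ _] := tg; apply: (@partition_mono n) iN _ => // k.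
exact: tpart_mono tg.
Qed.

(** Each term is the part of a cell's increment lying to the left of [y]; truncating all nodes at
    [y] turns the sum into a telescoping one. *)
Lemma clamp_partition_sum (g : R -> R) n (x : nat -> R) y :
  (forall i, (i < n)%N -> x i <= x i.+1) -> x 0%N <= y <= x n ->
  \sum_(i < n) (g (clamp (x i) (x i.+1) y) - g (x i)) = g y - g (x 0%N).
Proof.
move=> xm /andP[y0 yn].
transitivity (\sum_(i < n) (g (Num.min (x i.+1) y) - g (Num.min (x i) y))).
  apply: eq_bigr => i _; have xi := xm i (ltn_ord i).
  have [yx|xy] := leP y (x i).
    by rewrite clamp_lo// !subrr min_r ?subrr//; exact: le_trans xi.
  by rewrite /clamp (max_r (ltW xy)).
rewrite (telescope_ord (fun i => g (Num.min (x i) y))).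
by rewrite min_r// min_l.
Qed.

(* Both sums are rewritten over the common refinement [c i j]. *)
Lemma RSsum_close f g v lo hi e d n x xi m y zeta :
  controls v g lo hi -> 0 <= e ->
  (forall s t, lo <= s <= hi -> lo <= t <= hi -> `|s - t| < 2 * d ->
     `|f s - f t| <= e) ->
  tpart n x xi lo hi d -> tpart m y zeta lo hi d ->
  `|RSsum f g n x xi - RSsum f g m y zeta| <= e * (v hi - v lo).
Proof.
move=> gv e0 fe tx ty.
pose c i j := clamp (x i) (x i.+1) (y j).
pose D i j := g (c i j.+1) - g (c i j).
have [x0 xn xt xd] := tx; have [y0 yn yt yd] := ty.
have c0 i : (i < n)%N -> c i 0%N = x i.
  move=> iN; rewrite /c clamp_lo//; first exact: tpart_mono tx iN.
  by rewrite y0; exact: tpart_lo tx (ltnW iN).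
have cm i : (i < n)%N -> c i m = x i.+1.
  move=> iN; rewrite /c clamp_hi//; first exact: tpart_mono tx iN.
  by rewrite yn; exact: tpart_hi tx iN.
have cin i j : (i < n)%N -> lo <= c i j <= hi.
  move=> iN; have /andP[h1 h2] := clamp_in (y j) (tpart_mono tx iN).
  have := tpart_lo tx (ltnW iN); have := tpart_hi tx iN.
  rewrite /c; lra.
have cmono i j : (j < m)%N -> c i j <= c i j.+1.
  by move=> jm; apply: clamp_mono; exact: tpart_mono ty jm.
have Dx i : (i < n)%N -> \sum_(j < m) D i j = g (x i.+1) - g (x i).
  by move=> iN; rewrite (telescope_ord (fun j => g (c i j))) c0// cm.
have Dy j : (j < m)%N -> \sum_(i < n) D i j = g (y j.+1) - g (y j).
  move=> jm.
  have E k : (k <= m)%N -> \sum_(i < n) (g (c i k) - g (x i)) = g (y k) - g lo.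
    move=> km; rewrite -x0; apply: (@clamp_partition_sum g n x (y k)).
      by move=> i iN; exact: tpart_mono tx iN.
    by rewrite x0 xn (tpart_lo ty km) (tpart_hi ty km).
  transitivity (\sum_(i < n) (g (c i j.+1) - g (x i)) - \sum_(i < n) (g (c i j) - g (x i))).
    by rewrite -sumrB; apply: eq_bigr => i _; rewrite /D; ring.
  by rewrite !E//; [ring|exact: ltnW].
have -> : RSsum f g n x xi = \sum_(i < n) \sum_(j < m) D i j *: f (xi i).
  by apply: eq_bigr => i _; rewrite -scaler_suml Dx.
have -> : RSsum f g m y zeta = \sum_(i < n) \sum_(j < m) D i j *: f (zeta j).
  by rewrite exchange_big/=; apply: eq_bigr => j _; rewrite -scaler_suml Dy.
rewrite -sumrB.
under eq_bigr => i _ do rewrite -sumrB.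
have -> : e * (v hi - v lo) = \sum_(i < n) \sum_(j < m) e * (v (c i j.+1) - v (c i j)).
  transitivity (\sum_(i < n) e * (v (x i.+1) - v (x i))).
    by rewrite -mulr_sumr (telescope_ord (fun i => v (x i))) x0 xn.
  apply: eq_bigr => i _.
  by rewrite -mulr_sumr (telescope_ord (fun j => v (c i j))) c0// cm.
apply: le_trans (ler_norm_sum _ _ _) _; apply: ler_sum => i _.
apply: le_trans (ler_norm_sum _ _ _) _; apply: ler_sum => j _.
have iN := ltn_ord i; have jm := ltn_ord j.
rewrite -scalerBr normrZ /D.
have cc := cmono i j jm.
have [h1 h2] : lo <= c i j /\ c i j.+1 <= hi.
  by have /andP[] := cin i j iN; have /andP[] := cin i j.+1 iN.
(* A degenerate cell has zero weight; it is set aside because its two tags may be far apart. *)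
have [cE|ne] := eqVneq (c i j) (c i j.+1).
  by rewrite cE !subrr normr0 mul0r mulr0.
have lt : c i j < c i j.+1 by rewrite lt_neqAle ne.
rewrite mulrC; apply: ler_pM => //; last exact: gv.
have /andP[t1 t2] := xt i iN; have /andP[t3 t4] := yt j jm.
have := tpart_lo tx (ltnW iN); have := tpart_hi tx iN.
have := tpart_lo ty (ltnW jm); have := tpart_hi ty jm.
have := xd i iN; have := yd j jm => l1 l2 l3 l4 l5 l6.
(* A nondegenerate refined cell forces the [i]-th cell of [x] and the [j]-th cell of [y] to overlap,
   so that their tags are less than [2 * d] apart. *)
have ox : y j < x i.+1.
  rewrite ltNge; apply/negP => le; move: lt; rewrite /c.
  rewrite (clamp_hi (tpart_mono tx iN) le).
  have /andP[_] := clamp_in (y j.+1) (tpart_mono tx iN); lra.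
have oy : x i < y j.+1.
  rewrite ltNge; apply/negP => le; move: lt; rewrite /c.
  rewrite (clamp_lo (tpart_mono tx iN) le).
  have /andP[] := clamp_in (y j) (tpart_mono tx iN); lra.
by apply: fe; rewrite ?ltr_norml; lra.
Qed.

Definition upart lo hi N i : R := lo + (hi - lo) * i%:R / N.+1%:R.

Lemma upart_tpart lo hi N d : lo <= hi -> (hi - lo) / N.+1%:R < d ->
  tpart N.+1 (upart lo hi N) (upart lo hi N) lo hi d.
Proof.
move=> lohi h.
have step i : upart lo hi N i.+1 - upart lo hi N i = (hi - lo) / N.+1%:R.
  by rewrite /upart -[i.+1%:R]natr1; field; rewrite addrC natr1 pnatr_eq0.
have N0 : 0 <= (hi - lo) / N.+1%:R by rewrite divr_ge0// subr_ge0.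
split.
- by rewrite /upart mulr0 mul0r addr0.
- by rewrite /upart mulfK ?pnatr_eq0// addrC subrK.
- by move=> i _; rewrite lexx/= -subr_ge0 step.
- by move=> i _; rewrite step.
Qed.

Lemma mesh_small lo hi d : lo <= hi -> 0 < d ->
  exists N0, forall N, (N0 <= N)%N -> (hi - lo) / N.+1%:R < d.
Proof.
move=> lohi d0.
exists (Num.bound ((hi - lo) / d)) => N hN.
rewrite ltr_pdivrMr// -ltr_pdivrMl// mulrC.
apply: lt_le_trans (archi_boundP _) _; first by rewrite divr_ge0 ?subr_ge0// ltW.
by rewrite ler_nat; exact: leqW.
Qed.

Lemma tpart_exists lo hi d : lo <= hi -> 0 < d ->
  exists n x, tpart n x x lo hi d.
Proof.
move=> lohi d0; have [N /(_ N (leqnn N)) h] := mesh_small lohi d0.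
by exists N.+1, (upart lo hi N); exact: upart_tpart.
Qed.

Lemma is_RSintP f g lo hi I : is_RSint f g lo hi I <->
  forall e, 0 < e -> exists2 d, 0 < d & forall n x xi,
    tpart n x xi lo hi d -> `|RSsum f g n x xi - I| < e.
Proof.
split=> H e e0; have [d d0 Hd] := H e e0; exists d => //.
  by move=> n x xi []; exact: Hd.
by move=> n x xi *; exact: Hd.
Qed.

Lemma RS_exists f g v lo hi : lo <= hi -> cont_on lo hi f ->
  controls v g lo hi -> exists I, is_RSint f g lo hi I.
Proof.
move=> lohi cf gv.
have V0 : 0 <= v hi - v lo by exact: le_trans (gv _ _ _ lohi _).
(* Dividing by the variation plus one covers a vanishing variation and keeps the final inequality
   strict. *)
have V1 : 0 < v hi - v lo + 1 by lra.
have close e : 0 < e -> exists2 d, 0 < d & forall n x xi m y zeta,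
    tpart n x xi lo hi d -> tpart m y zeta lo hi d ->
    `|RSsum f g n x xi - RSsum f g m y zeta| < e.
  move=> e0.
  have e1 : 0 < e / (v hi - v lo + 1) by rewrite divr_gt0.
  have [d d0 Hd] := cont_on_uniform cf e1.
  exists (d / 2); first by rewrite divr_gt0.
  move=> n x xi m y zeta tx ty.
  apply: le_lt_trans (RSsum_close gv (ltW e1) _ tx ty) _.
    by move=> s t hs ht st; apply/ltW/Hd => //; lra.
  rewrite mulrAC ltr_pdivrMr// ltr_pM2l//; lra.
pose u N := RSsum f g N.+1 (upart lo hi N) (upart lo hi N).
have [|I HI] := @cauchy_limit R X u.
  move=> e e0; have [d d0 Hd] := close e e0.
  have [N HN] := mesh_small lohi d0; exists N => n m Nn Nm.
  by apply: Hd; apply: upart_tpart => //; exact: HN.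
exists I; apply/is_RSintP => e e0.
have e20 : 0 < e / 2 by rewrite divr_gt0.
have [d d0 Hd] := close _ e20; exists d => // n x xi tx.
have [N HN] := mesh_small lohi d0; have [M HM] := HI _ e20.
have h1 := HM _ (leq_maxr N M); have h2 := HN _ (leq_maxl N M).
have := Hd _ _ _ _ _ _ tx (upart_tpart lohi h2).
rewrite -/(u _) => h3.
have := ler_distD (u (maxn N M)) (RSsum f g n x xi) I; lra.
Qed.

Lemma RSint_is f g v lo hi : lo <= hi -> cont_on lo hi f ->
  controls v g lo hi -> is_RSint f g lo hi (RSint f g lo hi).
Proof.
by move=> lohi cf gv; have [I HI] := RS_exists lohi cf gv;
  exact: (@xgetPex _ 0 _ (ex_intro _ I HI)).
Qed.

Lemma small_norm_eq (x y : X) : (forall e, 0 < e -> `|x - y| < e) -> x = y.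
Proof.
move=> H; apply/eqP; rewrite -subr_eq0 -normr_le0.
by apply/ler_addgt0Pl => e e0; rewrite addr0; apply/ltW/H.
Qed.

Lemma RS_unique f g lo hi I J : lo <= hi ->
  is_RSint f g lo hi I -> is_RSint f g lo hi J -> I = J.
Proof.
move=> lohi /is_RSintP HI /is_RSintP HJ; apply: small_norm_eq => e e0.
have e20 : 0 < e / 2 by rewrite divr_gt0.
have [d1 d10 H1] := HI _ e20; have [d2 d20 H2] := HJ _ e20.
have d0 : 0 < Num.min d1 d2 by rewrite lt_min d10.
have [n [x [x0 xn xt xd]]] := tpart_exists lohi d0.
have h1 : `|RSsum f g n x x - I| < e / 2.
  by apply: H1; split=> // i /xd; rewrite lt_min => /andP[].
have h2 : `|RSsum f g n x x - J| < e / 2.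
  by apply: H2; split=> // i /xd; rewrite lt_min => /andP[].
rewrite distrC in h1; have := ler_distD (RSsum f g n x x) I J; lra.
Qed.

(** [H] stands for a primitive of the bound on the integrand, so that weighted estimates need no
    real integral. Sums with left tags suffice, hence [f] is only evaluated at [x]. *)
Lemma RS_bound f g H lo hi I : lo <= hi -> is_RSint f g lo hi I ->
  (forall x y, lo <= x -> x <= y -> y <= hi ->
     `|g y - g x| * `|f x| <= H y - H x) ->
  `|I| <= H hi - H lo.
Proof.
move=> lohi /is_RSintP HI HH; apply/ler_addgt0Pl => e e0.
have [d d0 Hd] := HI e e0; have [n [x tx]] := tpart_exists lohi d0.
have [x0 xn _ _] := tx.
have h1 := Hd _ _ _ tx.
have h2 : `|RSsum f g n x x| <= H hi - H lo.
  rewrite -xn -x0 -(telescope_ord (fun i => H (x i))).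
  apply: le_trans (ler_norm_sum _ _ _) _; apply: ler_sum => i _.
  have iN := ltn_ord i; rewrite normrZ; apply: HH.
  - exact: tpart_lo tx (ltnW iN).
  - exact: tpart_mono tx iN.
  - exact: tpart_hi tx iN.
have := ler_distD (RSsum f g n x x) I 0; rewrite !subr0 distrC; lra.
Qed.

Lemma RSB f1 f2 g lo hi I1 I2 : is_RSint f1 g lo hi I1 -> is_RSint f2 g lo hi I2 ->
  is_RSint (fun x => f1 x - f2 x) g lo hi (I1 - I2).
Proof.
move=> /is_RSintP H1 /is_RSintP H2; apply/is_RSintP => e e0.
have e20 : 0 < e / 2 by rewrite divr_gt0.
have [d1 d10 K1] := H1 _ e20; have [d2 d20 K2] := H2 _ e20.
exists (Num.min d1 d2); first by rewrite lt_min d10.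
move=> n x xi [x0 xn xt xd].
have h1 : `|RSsum f1 g n x xi - I1| < e / 2.
  by apply: K1; split=> // i /xd; rewrite lt_min => /andP[].
have h2 : `|RSsum f2 g n x xi - I2| < e / 2.
  by apply: K2; split=> // i /xd; rewrite lt_min => /andP[].
have -> : RSsum (fun x => f1 x - f2 x) g n x xi = RSsum f1 g n x xi - RSsum f2 g n x xi.
  by rewrite /RSsum -sumrB; apply: eq_bigr => i _; rewrite scalerBr.
rewrite opprD addrACA -opprD.
by apply: le_lt_trans (ler_normB _ _) _; lra.
Qed.

(** Concatenating partitions of the two parts yields a partition of the whole segment with [mid] as
    a node, for which additivity of the sums is exact. *)
Lemma RS_additive f g lo mid hi I I1 I2 : lo <= mid -> mid <= hi ->
  is_RSint f g lo hi I -> is_RSint f g lo mid I1 -> is_RSint f g mid hi I2 ->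
  I = I1 + I2.
Proof.
move=> lm mh /is_RSintP H /is_RSintP H1 /is_RSintP H2; apply: small_norm_eq => e e0.
have e30 : 0 < e / 3 by rewrite divr_gt0.
have [d d0 K] := H _ e30; have [d1 d10 K1] := H1 _ e30; have [d2 d20 K2] := H2 _ e30.
have dd0 : 0 < Num.min d (Num.min d1 d2) by rewrite !lt_min d0 d10.
have [n [x tx]] := tpart_exists lm dd0; have [m [y ty]] := tpart_exists mh dd0.
have [x0 xn xt xd] := tx; have [y0 yn yt yd] := ty.
have h1 : `|RSsum f g n x x - I1| < e / 3.
  by apply: K1; split=> // i /xd; rewrite !lt_min => /and3P[].
have h2 : `|RSsum f g m y y - I2| < e / 3.
  by apply: K2; split=> // i /yd; rewrite !lt_min => /and3P[].
pose z i := if (i <= n)%N then x i else y (i - n)%N.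
have zl i : (i <= n)%N -> z i = x i by rewrite /z => ->.
have zr i : z (n + i)%N = y i.
  rewrite /z; case: leqP; last by rewrite addKn.
  by rewrite -{2}[n]addn0 leq_add2l leqn0 => /eqP ->; rewrite addn0 xn y0.
have tz : tpart (n + m) z z lo hi d.
  have zz i : (i < n + m)%N -> z i <= z i.+1 /\ z i.+1 - z i < d.
    move=> inm; have [iN|ni] := ltnP i n.
      rewrite !zl//; last exact: ltnW.
      split; first exact: tpart_mono tx iN.
      by have := xd i iN; rewrite !lt_min => /and3P[].
    rewrite -(subnKC ni) -addnS !zr.
    have im : (i - n < m)%N by rewrite ltn_subLR.
    split; first exact: tpart_mono ty im.
    by have := yd _ im; rewrite !lt_min => /and3P[].
  split.
  - by rewrite zl.
  - by rewrite zr.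
  - by move=> i /zz[]; rewrite lexx.
  - by move=> i /zz[].
have h := K _ _ _ tz.
have E : RSsum f g (n + m) z z = RSsum f g n x x + RSsum f g m y y.
  rewrite /RSsum big_split_ord/=; congr (_ + _); apply: eq_bigr => i _.
    by rewrite !zl//; exact: ltnW.
  by rewrite -addnS !zr.
rewrite E in h.
rewrite (_ : I - (I1 + I2) = (RSsum f g n x x - I1) + (RSsum f g m y y - I2) -
   (RSsum f g n x x + RSsum f g m y y - I)); last first.
  by rewrite [X in _ = X - _]addrACA -opprD opprB [RHS]addrC addrA subrK.
apply: le_lt_trans (ler_normB _ _) _.
have := ler_normD (RSsum f g n x x - I1) (RSsum f g m y y - I2); lra.
Qed.

End RSIntegral.

(** * Integrators with jumps *)

(** A nonempty open interval has positive Lebesgue measure, a countable set has measure zero. *)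
Lemma avoid_countable (R : realType) (A : set R) (x y : R) : countable A -> x < y ->
  exists2 z, x < z < y & ~ A z.
Proof.
move=> cA xy; apply: contrapT => H.
have sub : `]x, y[ `<=` A.
  move=> z /=; rewrite in_itv/= => xzy; apply: contrapT => nAz.
  by apply: H; exists z.
have c0 : countable `]x, y[%classic by exact: sub_countable (subset_card_le sub) cA.
have := countable_lebesgue_measure0 c0.
rewrite lebesgue_measure_itv/= lte_fin xy -EFinB => /eqP.
by rewrite eqe subr_eq0 gt_eqF.
Qed.

Lemma partition_avoiding (R : realType) (A : set R) (lo hi d : R) :
  countable A -> lo < hi -> 0 < d ->
  exists n x, [/\ (0 < n)%N, tpart n x x lo hi d &
    forall i, (0 < i < n)%N -> lo < x i < hi /\ ~ A (x i)].
Proof.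
move=> cA lohi d0; have d20 : 0 < d / 2 by rewrite divr_gt0.
have [N /(_ N (leqnn N)) h] := mesh_small (ltW lohi) d20.
pose st := (hi - lo) / N.+1%:R.
have st0 : 0 < st by rewrite divr_gt0// subr_gt0.
pose z := upart lo hi N.
have hst : st < d / 2 by exact: h.
have step i : z i.+1 = z i + st.
  by rewrite /z /upart /st -[i.+1%:R]natr1; field; rewrite addrC natr1 pnatr_eq0.
have [z0 zN _ _] := upart_tpart (ltW lohi) h.
(* One admissible point is chosen in each cell of a uniform partition with step below [d / 2]:
   neighbouring choices are less than two steps apart. The endpoints are kept. *)
have /choice[w Hw] : forall i, exists w, z i < w < z i.+1 /\ ~ A w.
  move=> i; have [|w wi Aw] := avoid_countable cA (x := z i) (y := z i.+1).
    by rewrite step ltrDl.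
  by exists w.
have zlo i : lo <= z i.
  by elim: i => [|i IHi]; [rewrite /z z0|rewrite step; lra].
have zhi i : (i <= N.+1)%N -> z i <= hi.
  move=> iN; rewrite -zN; apply: (@partition_mono _ N.+1) => // k _.
  by rewrite -/z step lerDl ltW.
move: (st) st0 hst step => {}st st0 hst step.
pose x i := if i is j.+1 then (if (j <= N)%N then w j else hi) else lo.
have xx i : (i < N.+2)%N -> x i <= x i.+1 /\ x i.+1 - x i < d.
  case: i => [_|i iN] /=.
    have [/andP[h1 h2] _] := Hw 0%N; rewrite step in h2.
    by have z0' : z 0%N = lo := z0; split; lra.
  rewrite ltnS in iN; rewrite (_ : (i <= N)%N)//.
  have [/andP[h1 h2] _] := Hw i; rewrite step in h2.
  case: ltnP => iN'.
    have [/andP[h3 h4] _] := Hw i.+1; rewrite !step in h3 h4.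
    by split; lra.
  have iE : i = N by apply/eqP; rewrite eqn_leq -ltnS iN.
  have := zhi i.+1; rewrite iE leqnn => /(_ isT) h5.
  have h6 : z N.+1 = hi by exact: zN.
  rewrite iE in h1 h2; rewrite step in h6 h5; split; lra.
exists N.+2, x; split => //.
  split=> //=; first by rewrite ltnn.
    by move=> i /xx[]; rewrite lexx.
  by move=> i /xx[].
case=> //= i iN; rewrite 2!ltnS in iN; rewrite iN.
have [/andP[h1 h2] Aw] := Hw i; split=> //.
have := zlo i; have := zhi i.+1; rewrite ltnS iN => /(_ isT); lra.
Qed.

Section JumpPart.
Context {R : realType} {X : completeNormedModType R}.

(** The membership rule of [is_jump_part]: cells touching [- r] or [0] are closed there, so that a
    jump at an endpoint is counted too. *)
Definition in_cell (r x y z : R) : bool :=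
  ((x < z) || (x == - r)) && ((z < y) || (y == 0)).

Lemma in_cell_sum r d n (x : nat -> R) z : (0 < n)%N -> tpart n x x (- r) 0 d ->
  (forall i, (0 < i < n)%N -> - r < x i < 0 /\ z != x i) ->
  \sum_(i < n) (in_cell r (x i) (x i.+1) z)%:R = 1 :> R.
Proof.
move=> n0 tx xi; have [x0 xn _ _] := tx.
(* [al i] tells whether node [i] lies left of [z], forced to be true at the first node and false at
   the last. It is nonincreasing, and the indicator of a cell is its drop across that cell. *)
pose al i := (i == 0%N) || ((i < n)%N && (x i < z)).
have E i : (i < n)%N ->
    (in_cell r (x i) (x i.+1) z)%:R = - (al i.+1)%:R - - (al i)%:R :> R.
  move=> iN.
  have h1 : ((x i < z) || (x i == - r)) = al i.
    rewrite /al iN/=; case: i iN => [|i] iN; first by rewrite x0 eqxx orbT.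
    by have [/andP[h _] _] := xi i.+1 iN; rewrite (gt_eqF h) orbF.
  have h2 : ((z < x i.+1) || (x i.+1 == 0)) = ~~ al i.+1.
    rewrite /al/=; have [iN'|iN'] := ltnP i.+1 n.
      have [/andP[_ h] zx] := xi i.+1 iN'.
      by rewrite (lt_eqF h) orbF /= -leNgt le_eqVlt (negPf zx).
    have -> : i.+1 = n by apply/eqP; rewrite eqn_leq iN.
    by rewrite xn eqxx orbT.
  have h3 : al i.+1 -> al i.
    rewrite {1}/al/= => /andP[_ h]; rewrite /al iN.
    by rewrite (le_lt_trans (tpart_mono tx iN) h) orbT.
  rewrite /in_cell h1 h2; move: h3; case: (al i); case: (al i.+1) => //=.
  - by rewrite subrr.
  - by rewrite oppr0 sub0r opprK.
  - by move=> /(_ isT).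
  - by rewrite subrr.
rewrite (eq_bigr (fun i : 'I_n => - (al i.+1)%:R - - (al i)%:R)); last first.
  by move=> i _; exact: E.
rewrite (telescope_ord (fun i => - (al i)%:R)) /al eqxx/= ltnn/=.
by rewrite (gtn_eqF n0) oppr0 sub0r opprK.
Qed.

Definition tails_le (h : nat -> R) N e := forall m, \sum_(N <= k < m) `|h k| <= e.

(** [rsum] is a limit with a default value for divergent series; domination by the absolutely
    summable [h] guarantees that it is the actual sum. *)
Lemma rsum_cvg (u h : nat -> R) : (forall k, `|u k| <= `|h k|) ->
  (forall e, 0 < e -> exists N, tails_le h N e) ->
  (fun n => \sum_(i < n) u i) @ \oo --> rsum u.
Proof.
move=> uh ht; rewrite /rsum.
suff : cvgn (fun n => \sum_(i < n) u i) by [].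
have tail n m N e : (N <= n)%N -> (n <= m)%N -> tails_le h N e ->
    `|\sum_(i < m) u i - \sum_(i < n) u i| <= e.
  move=> Nn nm hN; rewrite -!(big_mkord xpredT u).
  rewrite (big_cat_nat (leq0n n) nm)/= addrAC subrr add0r.
  apply: le_trans (ler_norm_sum _ _ _) _.
  apply: (le_trans (ler_sum _ (fun k _ => uh k))).
  apply: le_trans (hN m); rewrite [leRHS](big_cat_nat Nn nm)/= lerDr.
  by apply: sumr_ge0.
have [|l Hl] := @cauchy_limit R R (fun n => \sum_(i < n) u i).
  move=> e e0; have e20 : 0 < e / 2 by rewrite divr_gt0.
  have [N HN] := ht _ e20; exists N => n m Nn Nm.
  apply: (@le_lt_trans _ _ (e / 2)); last by lra.
  have [nm|mn] := leqP n m; first by rewrite distrC; exact: (tail _ _ N).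
  by apply: (tail _ _ N) => //; exact: ltnW.
apply/cvg_ex; exists l; apply/cvgrPdist_lt => e /Hl[N HN].
by exists N => // n /HN; rewrite distrC.
Qed.

(** Increments of [gd] are series over the jumps; exchanging the finite sum over cells with these
    series regroups the Riemann-Stieltjes sum by jumps. The first [N] jumps are moved to their exact
    location, each at cost [e] times its size; the others cost at most [e1 * K] together. *)
Lemma jump_sum_close r (gd : R -> R) (eta h : nat -> R) (f : R -> X)
    n x d K e e1 N :
  is_jump_part r gd eta h -> (forall k, 0 <= eta k <= r) ->
  (forall e, 0 < e -> exists N, tails_le h N e) ->
  tails_le h N e1 -> (0 < n)%N -> tpart n x x (- r) 0 d ->
  (forall i, (0 < i < n)%N -> - r < x i < 0 /\ forall k, - eta k != x i) ->
  0 <= K -> (forall s, - r <= s <= 0 -> `|f s| <= K) ->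
  0 <= e -> (forall s t, - r <= s <= 0 -> - r <= t <= 0 -> `|s - t| < d ->
     `|f s - f t| <= e) ->
  `|RSsum f gd n x x - \sum_(k < N) h k *: f (- eta k)| <=
     e * (\sum_(k < N) `|h k|) + e1 * K.
Proof.
move=> [_ jump] eta_r ht hN n0 tx xi K0 fK e0 fe.
have [x0 xn _ xd] := tx.
pose c i k : R := (in_cell r (x i) (x i.+1) (- eta k))%:R.
have csum k : \sum_(i < n) c i k = 1.
  by apply: in_cell_sum n0 tx _ => i /xi[].
have c0 i k : 0 <= c i k by rewrite ler0n.
have xr i : (i <= n)%N -> - r <= x i <= 0.
  by move=> iN; rewrite (tpart_lo tx iN) (tpart_hi tx iN).
have er k : - r <= - eta k <= 0 by have := eta_r k; lra.
pose v i k := c i k * h k.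
have gdE i : (i < n)%N -> gd (x i.+1) - gd (x i) = rsum (v i).
  move=> iN; have /andP[x1 x2] := xr _ (ltnW iN); have /andP[x3 x4] := xr _ iN.
  rewrite jump//.
  - congr rsum; apply/funext => k; rewrite /v /c -/(in_cell _ _ _ _).
    by case: in_cell; rewrite ?mul1r ?mul0r.
  - exact: tpart_mono tx iN.
  - case: i iN {x1 x2 x3 x4} => [|i] iN; first by left.
    by right; have [] := xi i.+1 iN.
  - have [iN'|iN'] := ltnP i.+1 n; first by right; have [] := xi i.+1 iN'.
    by left; rewrite -xn; congr x; apply/eqP; rewrite eqn_leq iN.
(* The value of [f] at the left node of the one cell that contains [- eta k]. *)
pose q k := \sum_(i < n) c i k *: f (x i).
pose P m := \sum_(i < n) (\sum_(k < m) v i k) *: f (x i).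
have Pq m : P m = \sum_(k < m) h k *: q k.
  rewrite /P; under eq_bigr do rewrite scaler_suml.
  rewrite exchange_big/=; apply: eq_bigr => k _.
  by rewrite /q scaler_sumr; apply: eq_bigr => i _; rewrite scalerA mulrC.
have Plim : P @ \oo --> RSsum f gd n x x.
  rewrite /RSsum /P; apply: cvg_big => [|i _]; first exact: add_continuous.
  rewrite gdE//; apply: cvgZr_tmp; apply: (@rsum_cvg _ h) => // k.
  rewrite /v normrM -[leRHS]mul1r ler_wpM2r//.
  by rewrite /c; case: in_cell; rewrite ?normr1 ?normr0.
have qK k : `|q k| <= K.
  apply: le_trans (ler_norm_sum _ _ _) _.
  rewrite -[K]mul1r -(csum k) mulr_suml; apply: ler_sum => i _.
  rewrite normrZ ger0_norm// ler_wpM2l// fK// xr//; exact: ltnW.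
have qe k : `|q k - f (- eta k)| <= e.
  rewrite -[f (- eta k)]scale1r -(csum k) scaler_suml -sumrB.
  apply: le_trans (ler_norm_sum _ _ _) _.
  rewrite -[e]mul1r -(csum k) mulr_suml; apply: ler_sum => i _.
  rewrite -scalerBr normrZ ger0_norm//.
  rewrite /c; case: (boolP (in_cell _ _ _ _)) => [|_]; last by rewrite !mul0r.
  move=> /andP[i1 i2]; rewrite !mul1r; have iN := ltn_ord i.
  have X1 := xr _ (ltnW iN); have X2 := er k.
  apply: fe => //.
  have h1 : x i <= - eta k by case/orP: i1 => [/ltW//|/eqP]; lra.
  have h2 : - eta k <= x i.+1 by case/orP: i2 => [/ltW//|/eqP]; lra.
  by have := xd i iN; rewrite distrC ger0_norm; lra.
(* The slack [e2] pays for passing from the full series to a partial sum with at least [N] jumps. *)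
apply/ler_addgt0Pr => e2 e20.
move/cvgrPdist_lt: Plim => /(_ _ e20)[M _ HM].
have /= h1 := HM _ (leq_maxl M N).
set m := maxn M N in h1.
have Nm : (N <= m)%N by exact: leq_maxr.
suff h2 : `|P m - \sum_(k < N) h k *: f (- eta k)| <=
    e * (\sum_(k < N) `|h k|) + e1 * K.
  have := ler_distD (P m) (RSsum f gd n x x) (\sum_(k < N) h k *: f (- eta k)).
  lra.
rewrite Pq -(big_mkord xpredT (fun k => h k *: q k)) (big_cat_nat (leq0n N) Nm)/=.
rewrite big_mkord addrAC -sumrB.
apply: le_trans (ler_normD _ _) _; apply: lerD.
  apply: le_trans (ler_norm_sum _ _ _) _; rewrite mulr_sumr; apply: ler_sum => k _.
  by rewrite -scalerBr normrZ mulrC ler_wpM2r.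
apply: le_trans (ler_norm_sum _ _ _) _.
apply: (@le_trans _ _ (\sum_(N <= k < m) `|h k| * K)).
  by apply: ler_sum => k _; rewrite normrZ ler_wpM2l.
by rewrite -mulr_suml ler_wpM2r.
Qed.

Lemma RSsum_bound (f : R -> X) g v lo hi d n x K : controls v g lo hi ->
  tpart n x x lo hi d -> 0 <= K -> (forall s, lo <= s <= hi -> `|f s| <= K) ->
  `|RSsum f g n x x| <= (v hi - v lo) * K.
Proof.
move=> gv tx K0 fK; have [x0 xn _ _] := tx.
rewrite -{1}xn -{1}x0 -(telescope_ord (fun i => v (x i))) mulr_suml.
apply: le_trans (ler_norm_sum _ _ _) _; apply: ler_sum => i _.
have iN := ltn_ord i; have i1 := tpart_lo tx (ltnW iN).
rewrite normrZ; apply: ler_pM => //.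
  apply: gv => //; [exact: tpart_mono tx iN|exact: tpart_hi tx iN].
by apply: fK; rewrite i1 (tpart_hi tx (ltnW iN)).
Qed.

(* The two integrators are compared through their continuous parts, up to the
   first [N] jumps: the partitions used avoid the jump points of both. *)
Lemma RS_jump_diff r (f1 f2 : R -> X) (g1 g2 gd1 gd2 v w : R -> R)
    (eta1 eta2 h1 h2 : nat -> R) D K N e M W I1 I2 :
  0 < r -> is_RSint f1 g1 (- r) 0 I1 -> is_RSint f2 g2 (- r) 0 I2 ->
  cont_on (- r) 0 f2 ->
  controls v g1 (- r) 0 -> v 0 - v (- r) <= M ->
  controls w (fun x => (g1 x - gd1 x) - (g2 x - gd2 x)) (- r) 0 ->
  w 0 - w (- r) <= W ->
  is_jump_part r gd1 eta1 h1 -> is_jump_part r gd2 eta2 h2 ->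
  (forall k, 0 <= eta1 k <= r) -> (forall k, 0 <= eta2 k <= r) ->
  (forall e, 0 < e -> exists N, tails_le h1 N e) ->
  (forall e, 0 < e -> exists N, tails_le h2 N e) ->
  tails_le h1 N e -> tails_le h2 N e ->
  0 <= D -> (forall s, - r <= s <= 0 -> `|f1 s - f2 s| <= D) ->
  0 <= K -> (forall s, - r <= s <= 0 -> `|f2 s| <= K) ->
  `|I1 - I2| <= M * D + W * K +
     \sum_(k < N) `|h1 k *: f2 (- eta1 k) - h2 k *: f2 (- eta2 k)| + 2 * e * K.
Proof.
move=> r0 /is_RSintP HI1 /is_RSintP HI2 cf2 g1v vM gcw wW j1 j2 er1 er2.
move=> ht1 ht2 hN1 hN2 D0 fD K0 fK; apply/ler_addgt0Pr => ep ep0.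
have ep40 : 0 < ep / 4 by rewrite divr_gt0.
pose s := \sum_(k < N) `|h1 k| + \sum_(k < N) `|h2 k|.
have s0 : 0 <= s by apply: addr_ge0; apply: sumr_ge0.
have s10 : 0 < s + 1 by lra.
have e'0 : 0 < ep / 4 / (s + 1) by rewrite divr_gt0.
have [d1 d10 H1] := HI1 _ ep40; have [d2 d20 H2] := HI2 _ ep40.
have [d3 d30 H3] := cont_on_uniform cf2 e'0.
pose d := Num.min d1 (Num.min d2 d3).
have d0 : 0 < d by rewrite !lt_min d10 d20.
(* Jump points of both integrators, the boolean selecting the integrator. *)
pose A := range (fun q : nat * bool => - if q.2 then eta1 q.1 else eta2 q.1).
have cA : countable A by exact: sub_countable (card_image_le _ _) (countableP _).
have mr0 : - r < 0 by rewrite oppr_lt0.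
have [n [x [n0 tx xA]]] := partition_avoiding cA mr0 d0.
have [x0 xn xt xd] := tx.
have S1 : `|RSsum f1 g1 n x x - I1| < ep / 4.
  by apply: H1; split=> // i /xd; rewrite !lt_min => /and3P[].
have S2 : `|RSsum f2 g2 n x x - I2| < ep / 4.
  by apply: H2; split=> // i /xd; rewrite !lt_min => /and3P[].
have fe y z : - r <= y <= 0 -> - r <= z <= 0 -> `|y - z| < d ->
    `|f2 y - f2 z| <= ep / 4 / (s + 1).
  by move=> hy hz; rewrite !lt_min => /and3P[_ _ yz]; apply/ltW/H3.
have xA1 i : (0 < i < n)%N -> - r < x i < 0 /\ forall k, - eta1 k != x i.
  move=> /xA[xi nA]; split=> // k; apply/eqP => E; apply: nA.
  by exists (k, true).
have xA2 i : (0 < i < n)%N -> - r < x i < 0 /\ forall k, - eta2 k != x i.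
  move=> /xA[xi nA]; split=> // k; apply/eqP => E; apply: nA.
  by exists (k, false).
have J1 := jump_sum_close j1 er1 ht1 hN1 n0 tx xA1 K0 fK (ltW e'0) fe.
have J2 := jump_sum_close j2 er2 ht2 hN2 n0 tx xA2 K0 fK (ltW e'0) fe.
set Q1 := \sum_(k < N) h1 k *: _ in J1.
set Q2 := \sum_(k < N) h2 k *: _ in J2.
set T1 := RSsum f1 g1 n x x in S1; set T2 := RSsum f2 g2 n x x in S2.
set G1 := RSsum f2 gd1 n x x in J1; set G2 := RSsum f2 gd2 n x x in J2.
(* At the level of sums, [f1 dg1 - f2 dg2] is [(f1 - f2) dg1], plus [f2] against the difference of
   the continuous parts, plus [f2] against the difference of the jump parts. *)
pose A1 := RSsum (fun y => f1 y - f2 y) g1 n x x.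
pose A2 := RSsum f2 (fun x => (g1 x - gd1 x) - (g2 x - gd2 x)) n x x.
have E : T1 - T2 = A1 + A2 + (G1 - G2).
  rewrite /T1 /T2 /A1 /A2 /G1 /G2 /RSsum -!sumrB -!big_split/=.
  apply: eq_bigr => i _; rewrite scalerBr -addrA -scalerBl -scalerDl.
  rewrite -addrA; congr (_ + _); rewrite -!scaleNr -scalerDl; congr (_ *: _); ring.
have B1 : `|A1| <= M * D.
  by apply: le_trans (RSsum_bound g1v tx D0 fD) _; rewrite ler_wpM2r.
have B2 : `|A2| <= W * K.
  by apply: le_trans (RSsum_bound gcw tx K0 fK) _; rewrite ler_wpM2r.
have BQ : `|Q1 - Q2| <= \sum_(k < N) `|h1 k *: f2 (- eta1 k) - h2 k *: f2 (- eta2 k)|.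
  by rewrite /Q1 /Q2 -sumrB; exact: ler_norm_sum.
have BE : ep / 4 / (s + 1) * \sum_(k < N) `|h1 k| +
          ep / 4 / (s + 1) * \sum_(k < N) `|h2 k| <= ep / 4.
  by rewrite -mulrDr -/s mulrAC ler_pdivrMr// ler_wpM2l ?ltW//; lra.
have T12 : `|T1 - T2| <= `|A1| + `|A2| + (`|G1 - Q1| + `|Q1 - Q2| + `|G2 - Q2|).
  rewrite E; apply: le_trans (ler_normD _ _) _; apply: lerD; first exact: ler_normD.
  have := ler_distD Q1 G1 G2; have := ler_distD Q2 Q1 G2; rewrite (distrC Q2); lra.
have I12 : `|I1 - I2| <= `|T1 - I1| + `|T1 - T2| + `|T2 - I2|.
  have := ler_distD T1 I1 I2; have := ler_distD T2 T1 I2; rewrite (distrC I1 T1); lra.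
lra.
Qed.

End JumpPart.

(** * Fixed points and the Duhamel integral *)

(** Iteration of the map from [m] to [c + m / 2], whose fixed point is [2 * c]: the contribution of
    the crude bound [D] is halved at every round, and [w >= 1] absorbs the constant [c] into the
    weight. *)
Lemma weighted_gap (R : realType) (lo hi : R) (d w : R -> R) (c D : R) :
  0 <= c -> 0 <= D -> (forall t, lo <= t <= hi -> 1 <= w t) ->
  (forall t, lo <= t <= hi -> d t <= D * w t) ->
  (forall m, 0 <= m -> (forall t, lo <= t <= hi -> d t <= m * w t) ->
     forall t, lo <= t <= hi -> d t <= c + m / 2 * w t) ->
  forall t, lo <= t <= hi -> d t <= 2 * c * w t.
Proof.
move=> c0 D0 w1 dD H t At.
have h0 n : 0 <= (2^-1 : R) ^+ n by rewrite exprn_ge0// invr_ge0.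
have step n : forall t, lo <= t <= hi -> d t <= (2 * c + D * 2^-1 ^+ n) * w t.
  elim: n => [s As|n IHn s As].
    apply: le_trans (dD s As) _; rewrite expr0 mulr1 ler_wpM2r//; last lra.
    exact: le_trans ler01 (w1 s As).
  have Dn : 0 <= D * 2^-1 ^+ n by rewrite mulr_ge0.
  apply: le_trans (H _ _ IHn s As) _; first lra.
  have := ler_wpM2l c0 (w1 s As); rewrite exprS; lra.
apply/ler_addgt0Pr => e e0.
have [N /(_ N (leqnn N)) hN] := mul_half_iter_small (D * w t) e0.
have := step N t At; lra.
Qed.

(** Banach's principle for the uniform distance on the segment, without a space of functions. That
    distance ignores values outside the segment, which is why the fixed-point equation is claimed on
    it only. *)
Lemma uniform_fixpoint (R : realType) (X : completeNormedModType R) (lo hi : R)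
    (Y : (R -> X) -> Prop) (Phi : (R -> X) -> R -> X) (u0 : R -> X) (D : R) :
  Y u0 -> (forall u, Y u -> Y (Phi u)) ->
  (forall u v (m : R), Y u -> Y v -> 0 <= m ->
     (forall s, lo <= s <= hi -> `|u s - v s| <= m) ->
     forall s, lo <= s <= hi -> `|Phi u s - Phi v s| <= m / 2) ->
  0 <= D -> (forall u v, Y u -> Y v -> forall s, lo <= s <= hi -> `|u s - v s| <= D) ->
  (forall u, (forall e : R, 0 < e -> exists2 v, Y v &
     forall s, lo <= s <= hi -> `|v s - u s| < e) -> Y u) ->
  exists2 u, Y u & forall s, lo <= s <= hi -> Phi u s = u s.
Proof.
move=> Y0 YP PC D0 YD Ycl.
pose un n := iter n Phi u0.
have Yn n : Y (un n) by elim: n => //= n; exact: YP.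
have h0 n : 0 <= (2^-1 : R) ^+ n by rewrite exprn_ge0// invr_ge0.
have step n : forall s, lo <= s <= hi -> `|un n.+1 s - un n s| <= D * 2^-1 ^+ n.
  elim: n => [s As|n IHn s As]; first by rewrite expr0 mulr1; exact: YD.
  rewrite exprSr mulrA; apply: (PC (un n.+1) (un n)) => //; exact: mulr_ge0 D0 (h0 n).
(* The factor [1 - 2^-1 ^+ k] is the exact partial sum of the geometric series and makes the
   induction on [k] close. *)
have gap n k s : lo <= s <= hi -> `|un (n + k)%N s - un n s| <= 2 * D * 2^-1 ^+ n * (1 - 2^-1 ^+ k).
  move=> As; elim: k => [|k IHk].
    by rewrite addn0 subrr normr0 expr0 subrr mulr0.
  have := step (n + k)%N s As; rewrite addnS exprD => h.
  have := ler_distD (un (n + k)%N s) (un (n + k).+1 s) (un n s).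
  have : D * (2^-1 ^+ n * 2^-1 ^+ k) = 2 * D * 2^-1 ^+ n * (2^-1 ^+ k - 2^-1 ^+ k.+1).
    by rewrite exprS; field.
  lra.
have gap' n m s : lo <= s <= hi -> (n <= m)%N -> `|un m s - un n s| <= 2 * D * 2^-1 ^+ n.
  move=> As nm; rewrite -(subnKC nm); apply: le_trans (gap _ _ _ As) _.
  rewrite -[leRHS]mulr1 ler_wpM2l//; first by rewrite mulr_ge0// mulr_ge0.
have /choice[u Hu] s : exists l, lo <= s <= hi ->
    forall e, 0 < e -> exists N, forall n, (N <= n)%N -> `|un n s - l| < e.
  have [As|nAs] := pselect (lo <= s <= hi); last by exists 0.
  have [|l Hl] := @cauchy_limit R X (fun n => un n s); last by exists l.
  move=> e e0; have [N HN] := mul_half_iter_small (2 * D) e0.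
  exists N => n m Nn Nm; have [nm|/ltnW mn] := leqP n m.
    by rewrite distrC; apply: le_lt_trans (gap' _ _ _ As nm) _; exact: HN.
  by apply: le_lt_trans (gap' _ _ _ As mn) _; exact: HN.
have lim n s : lo <= s <= hi -> `|un n s - u s| <= 2 * D * 2^-1 ^+ n.
  move=> As; apply/ler_addgt0Pr => e e0; have [N HN] := Hu s As e e0.
  have h1 := HN _ (leq_maxl N n); have h2 := gap' _ _ _ As (leq_maxr N n).
  have := ler_distD (un (maxn N n) s) (un n s) (u s).
  rewrite (distrC (un n s) (un _ s)); lra.
have Yu : Y u.
  apply: Ycl => e e0; have [N HN] := mul_half_iter_small (2 * D) e0.
  exists (un N) => // s As; exact: le_lt_trans (lim _ _ As) (HN _ (leqnn N)).
exists u => // s As; apply: small_norm_eq => e e0.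
have e20 : 0 < e / 2 by rewrite divr_gt0.
have [N /(_ N (leqnn N)) HN] := mul_half_iter_small (2 * D) e20.
have Dn : 0 <= 2 * D * 2^-1 ^+ N by rewrite mulr_ge0// mulr_ge0.
have h1 : `|Phi (un N) s - Phi u s| <= 2 * D * 2^-1 ^+ N / 2.
  by apply: PC => // t At; exact: lim.
have h2 : `|Phi (un N) s - u s| <= 2 * D * (2^-1 * 2^-1 ^+ N).
  by rewrite -exprS; exact: (lim N.+1).
have := ler_distD (Phi (un N) s) (Phi u s) (u s).
rewrite (distrC (Phi u s) (Phi (un N) s)); lra.
Qed.

(** * Semigroup bounds and regularity of the Duhamel integral *)

Section Semigroup.
Context {R : realType} {X : completeNormedModType R} (S : R -> X -> X) (omega : R).
Context (S0 : forall x, S 0 x = x)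
  (SD : forall (t s : R) x, 0 <= t -> 0 <= s -> S (t + s) x = S t (S s x))
  (Slin : forall t : R, 0 <= t ->
     forall (c : R) (x y : X), S t (c *: x + y) = c *: S t x + S t y)
  (Snorm : forall (t : R) x, 0 <= t -> `|S t x| <= expR (omega * t) * `|x|)
  (Scont : forall x, {within `[0, +oo[, continuous (fun t => S t x)}).

(** The absolute value makes the bound nondecreasing in time, and at least [1] for nonnegative
    times, whatever the sign of [omega]. *)
Definition sgbound (sig : R) : R := expR (`|omega| * sig).

Lemma sgbound_gt0 (sig : R) : 0 < sgbound sig.
Proof. exact: expR_gt0. Qed.

Lemma sgbound_ge1 (sig : R) : 0 <= sig -> 1 <= sgbound sig.
Proof. by move=> s0; rewrite /sgbound -expR0 ler_expR mulr_ge0. Qed.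

Lemma semigroup_norm_le (sig t : R) (x : X) : 0 <= t <= sig -> `|S t x| <= sgbound sig * `|x|.
Proof.
move=> /andP[t0 ts]; apply: le_trans (Snorm x t0) _; rewrite ler_wpM2r//.
rewrite ler_expR; apply: (@le_trans _ _ (`|omega| * t)).
  by rewrite ler_wpM2r// ler_norm.
by rewrite ler_wpM2l.
Qed.

Lemma semigroupB (t : R) (x y : X) : 0 <= t -> S t (x - y) = S t x - S t y.
Proof.
by move=> t0; rewrite addrC -scaleN1r Slin// scaleN1r addrC.
Qed.

Lemma semigroup_cont (x : X) (t0 e : R) : 0 <= t0 -> 0 < e -> exists2 d, 0 < d &
  forall t, 0 <= t -> `|t - t0| < d -> `|S t x - S t0 x| < e.
Proof.
move=> t00 e0; have /within_continuousP H := @Scont x.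
have [|d d0 Hd] := H t0 _ e e0; first by rewrite /= in_itv/= t00.
by exists d => // t tt; apply: Hd; rewrite /= in_itv/= tt.
Qed.

(** Strong continuity at time [0] becomes uniform along the compact image of [y], thanks to the
    common bound on [S t] for times below [1]. *)
Lemma semigroup_cont_unif (y : R -> X) (lo hi : R) : cont_on lo hi y ->
  forall e : R, 0 < e -> exists2 d, 0 < d & forall s, lo <= s <= hi ->
    forall t, 0 <= t -> t < d -> `|S t (y s) - y s| < e.
Proof.
move=> cy e e0; apply: (@itv_uniform R lo hi (fun d s => forall t, 0 <= t ->
  t < d -> `|S t (y s) - y s| < e)) => s As.
pose E := sgbound 1; have E1 : 1 <= E by exact: sgbound_ge1.
have e'0 : 0 < e / 3 / E by rewrite !divr_gt0 ?sgbound_gt0.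
have e30 : 0 < e / 3 by rewrite divr_gt0.
have [d1 d10 H1] := cy s As _ e'0.
have [d2 d20 H2] := @semigroup_cont (y s) 0 _ (lexx 0) e30.
exists (Num.min d1 (Num.min d2 1)); first by rewrite !lt_min d10 d20 ltr01.
move=> z Az; rewrite lt_min => /andP[zs _] k k0.
rewrite !lt_min => /and3P[_ kd2 k1] t t0 tk.
have h1 := H1 z Az zs.
have h2 : `|S t (y s) - y s| < e / 3.
  by have := H2 t t0; rewrite S0 subr0; apply; rewrite ger0_norm//; lra.
have h3 : `|S t (y z) - S t (y s)| < e / 3.
  rewrite -semigroupB//; apply: le_lt_trans (@semigroup_norm_le 1 _ _ _) _.
    by rewrite t0/=; lra.
  by rewrite mulrC -ltr_pdivlMr// sgbound_gt0.
have h4 : e / 3 / E <= e / 3.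
  by rewrite ler_pdivrMr ?sgbound_gt0// ler_peMr// ltW.
have := ler_distD (S t (y s)) (S t (y z)) (y z).
have := ler_distD (y s) (S t (y s)) (y z); rewrite (distrC (y s)); lra.
Qed.

Lemma duhamel_integrand_cont (y : R -> X) (a t : R) : cont_on a t y ->
  cont_on a t (fun s => S (t - s) (y s)).
Proof.
move=> cy s As e e0; pose E := sgbound (t - a).
have e'0 : 0 < e / 2 / E by rewrite !divr_gt0 ?sgbound_gt0.
have e20 : 0 < e / 2 by rewrite divr_gt0.
have ts0 : 0 <= t - s by lra.
have [d1 d10 H1] := cy s As _ e'0; have [d2 d20 H2] := semigroup_cont (y s) ts0 e20.
exists (Num.min d1 d2); first by rewrite lt_min d10.
move=> z Az; rewrite lt_min => /andP[z1 z2].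
have tz0 : 0 <= t - z by lra.
have h1 : `|S (t - z) (y z) - S (t - z) (y s)| < e / 2.
  rewrite -semigroupB//; apply: le_lt_trans (@semigroup_norm_le (t - a) _ _ _) _.
    by lra.
  by rewrite mulrC -ltr_pdivlMr ?sgbound_gt0//; exact: H1.
have h2 : `|S (t - z) (y s) - S (t - s) (y s)| < e / 2.
  by apply: H2 => //; rewrite (_ : t - z - (t - s) = - (z - s)) ?normrN//; ring.
have := ler_distD (S (t - z) (y s)) (S (t - z) (y z)) (S (t - s) (y s)); lra.
Qed.

Definition duhamel (a : R) (y : R -> X) (t : R) : X :=
  RSint (fun s => S (t - s) (y s)) id a t.

Lemma duhamel_is (a : R) (y : R -> X) (t : R) : a <= t -> cont_on a t y ->
  is_RSint (fun s => S (t - s) (y s)) id a t (duhamel a y t).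
Proof.
move=> a_t cy; exact: RSint_is a_t (duhamel_integrand_cont cy) (@controls_id R a t).
Qed.

Lemma duhamel_at (a : R) (y : R -> X) : duhamel a y a = 0.
Proof.
have cy : cont_on a a y.
  move=> x /andP[x1 x2] e e0; exists 1 => // z /andP[z1 z2] _.
  by rewrite (_ : z = x) ?subrr ?normr0//; lra.
have := duhamel_is (lexx a) cy => /(RS_bound (H := fun=> 0) (lexx a)).
rewrite subrr normr_le0 => H; apply/eqP/H => u v h1 h2 h3.
by rewrite (_ : u = v) ?subrr ?normr0 ?mul0r//; lra.
Qed.

(** [e] is an additive error and [q] the size of the difference in an exponentially weighted norm.
    Integration divides the weighted part by [lam]; this gain yields a contraction factor when [lam]
    is large. *)
Lemma duhamel_diff (a T sig e q lam t : R) (y1 y2 : R -> X) : cont_on a T y1 -> cont_on a T y2 ->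
  a <= t <= T -> T - a <= sig -> 0 <= e -> 0 <= q -> 0 < lam ->
  (forall s, a <= s <= T -> `|y1 s - y2 s| <= e + q * expR (lam * (s - a))) ->
  `|duhamel a y1 t - duhamel a y2 t| <=
     sgbound sig * (e * (t - a) + q / lam * expR (lam * (t - a))).
Proof.
move=> c1 c2 /andP[a_t tT] Ts e0 q0 l0 H.
pose E := sgbound sig; have E0 := sgbound_gt0 sig.
have sub (y : R -> X) : cont_on a T y -> cont_on a t y by exact: cont_on_sub.
have h := RSB (duhamel_is a_t (sub _ c1)) (duhamel_is a_t (sub _ c2)).
pose W x := E * (e * x + q / lam * expR (lam * (x - a))).
apply: le_trans (RS_bound (H := W) a_t h _) _.
  move=> x y ax xy yt; rewrite -semigroupB; last lra.
  rewrite ger0_norm ?subr_ge0//.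
  have b1 : `|S (t - x) (y1 x - y2 x)| <= E * (e + q * expR (lam * (x - a))).
    apply: le_trans (@semigroup_norm_le sig _ _ _) _; first by lra.
    by rewrite ler_wpM2l ?(ltW E0)// H//; lra.
  apply: le_trans (ler_wpM2l _ b1) _; first by lra.
  (* Since [1 + z <= expR z], left-tagged sums of the exponential stay below the increments of its
     primitive. *)
  have b2 : lam * (y - x) * expR (lam * (x - a)) <=
            expR (lam * (y - a)) - expR (lam * (x - a)).
    rewrite (_ : lam * (y - a) = lam * (y - x) + lam * (x - a)); last by ring.
    rewrite expRD -[X in _ <= _ - X]mul1r -mulrBl ler_wpM2r ?expR_ge0//.
    have := expR_ge1Dx (lam * (y - x)); lra.
  rewrite /W -mulrBr mulrCA ler_wpM2l ?(ltW E0)//.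
  have b3 := ler_wpM2l (divr_ge0 q0 (ltW l0)) b2.
  have b4 : q / lam * (lam * (y - x) * expR (lam * (x - a))) =
            q * ((y - x) * expR (lam * (x - a))) by field; rewrite gt_eqF.
  lra.
rewrite /W subrr mulr0 expR0 -mulrBr ler_wpM2l ?(ltW E0)//.
have : 0 <= q / lam by rewrite divr_ge0// ltW.
lra.
Qed.

Lemma duhamel_bound (a T sig C t : R) (y : R -> X) : cont_on a T y -> a <= t <= T -> T - a <= sig ->
  0 <= C -> (forall s, a <= s <= T -> `|y s| <= C) ->
  `|duhamel a y t| <= sgbound sig * (C * (t - a)).
Proof.
move=> cy /andP[a_t tT] Ts C0 yC; have E0 := sgbound_gt0 sig.
have cy' : cont_on a t y by exact: cont_on_sub cy.
apply: le_trans (RS_bound (H := fun x => sgbound sig * (C * x)) a_t (duhamel_is a_t cy') _) _.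
  move=> x z ax xz zt; rewrite ger0_norm ?subr_ge0// -mulrBr -mulrBr.
  rewrite mulrC mulrA ler_wpM2r ?subr_ge0//.
  apply: le_trans (@semigroup_norm_le sig _ _ _) _; first by lra.
  by rewrite ler_wpM2l ?(ltW E0)// yC//; lra.
by rewrite -!mulrBr.
Qed.

(** The integral up to [t'] is split at [t]. On the old part the extra time [t' - t] is applied
    first, directly to [y s], where strong continuity is uniform; the new part has a bounded
    integrand on a short interval. *)
Lemma duhamel_cont (a T : R) (y : R -> X) : cont_on a T y -> cont_on a T (duhamel a y).
Proof.
move=> cy.
have core (e : R) : 0 < e -> exists2 d, 0 < d & forall t t', a <= t -> t <= t' ->
    t' <= T -> t' - t < d -> `|duhamel a y t' - duhamel a y t| < e.
  move=> e0; have [Ta|aT] := ltP T a; first by exists 1 => // *; lra.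
  pose E := sgbound (T - a); have E0 : 0 < E := sgbound_gt0 _.
  have [C C0 yC] := cont_on_bounded cy.
  have e10 : 0 < e / 2 / (E * (T - a) + 1).
    rewrite !divr_gt0// ltr_wpDl// mulr_ge0//; [exact: ltW|lra].
  have [d1 d10 H1] := semigroup_cont_unif cy e10.
  have e20 : 0 < e / 2 / (E * C) by rewrite !divr_gt0// mulr_gt0.
  exists (Num.min d1 (e / 2 / (E * C))); first by rewrite lt_min d10.
  move=> t t' a_t tt' t'T; rewrite lt_min => /andP[l1 l2].
  have cy' : cont_on a t' y by exact: cont_on_sub cy.
  have ci' := duhamel_integrand_cont cy'.
  have i1 := duhamel_is (le_trans a_t tt') cy'.
  have i2 : is_RSint (fun s => S (t' - s) (y s)) id a t
    (RSint (fun s => S (t' - s) (y s)) id a t).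
    apply: (RSint_is a_t) (@controls_id R a t); exact: cont_on_sub ci'.
  have i3 : is_RSint (fun s => S (t' - s) (y s)) id t t'
    (RSint (fun s => S (t' - s) (y s)) id t t').
    apply: (RSint_is tt') (@controls_id R t t'); exact: cont_on_sub ci'.
  rewrite (RS_additive a_t tt' i1 i2 i3).
  set I2 := RSint _ _ a t in i2 *; set I3 := RSint _ _ t t' in i3 *.
  have i4 : is_RSint (fun s => S (t - s) (y s)) id a t (duhamel a y t).
    by apply: duhamel_is => //; apply: cont_on_sub cy => //; lra.
  have b1 : `|I2 - duhamel a y t| <= E * (e / 2 / (E * (T - a) + 1)) * t -
        E * (e / 2 / (E * (T - a) + 1)) * a.
    apply: (RS_bound (H := fun x => E * (e / 2 / (E * (T - a) + 1)) * x) a_t (RSB i2 i4)).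
    move=> x z ax xz zt; rewrite ger0_norm ?subr_ge0// -mulrBr mulrC.
    rewrite ler_wpM2r ?subr_ge0//.
    rewrite (_ : t' - x = (t - x) + (t' - t)); last by ring.
    rewrite SD; [|lra|lra]; rewrite -semigroupB; last by lra.
    apply: le_trans (@semigroup_norm_le (T - a) _ _ _) _; first by lra.
    by rewrite ler_wpM2l ?(ltW E0)//; apply/ltW/H1; lra.
  have b2 : `|I3| <= E * C * t' - E * C * t.
    apply: (RS_bound (H := fun x => E * C * x) tt' i3) => x z ax xz zt.
    rewrite ger0_norm ?subr_ge0// -mulrBr mulrC ler_wpM2r ?subr_ge0//.
    apply: le_trans (@semigroup_norm_le (T - a) _ _ _) _; first by lra.
    by rewrite ler_wpM2l ?(ltW E0)//; apply: yC; lra.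
  have b3 : E * C * (t' - t) < e / 2.
    by rewrite mulrC -ltr_pdivlMr// mulr_gt0.
  have b4 : E * (e / 2 / (E * (T - a) + 1)) * (t - a) <= e / 2.
    rewrite -mulrA [_ / _ * _]mulrAC mulrA ler_pdivrMr; last first.
      by rewrite ltr_wpDl// mulr_ge0//; [exact: ltW|lra].
    rewrite mulrCA ler_wpM2l//; first by lra.
    have : E * (t - a) <= E * (T - a) by rewrite ler_wpM2l ?(ltW E0)//; lra.
    lra.
  rewrite addrAC; apply: le_lt_trans (ler_normD _ _) _; lra.
move=> x Ax e e0; have [d d0 H] := core e e0; exists d => // z Az.
have [xz|/ltW zx] := leP x z.
  by rewrite (@ger0_norm _ (z - x)) ?subr_ge0// => zx; apply: H => //; lra.
by rewrite distrC (distrC (duhamel _ _ _)) ger0_norm ?subr_ge0// => xz; apply: H => //; lra.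
Qed.

End Semigroup.

(** * Abstract evolution equations with delay *)

Section SupNorm.
Context {R : realType} {X : completeNormedModType R} (r : R) (r0 : 0 < r).
Implicit Types phi psi : R -> X.

Lemma supnorm_ub phi (th : R) : inC r phi -> - r <= th <= 0 -> `|phi th| <= supnorm r phi.
Proof.
move=> /cont_onP/cont_on_bounded[K _ HK] Ath; apply: ub_le_sup.
  by exists K => _ [x /= + <-]; rewrite in_itv/=; exact: HK.
by exists th => //=; rewrite in_itv.
Qed.

Lemma supnorm_le phi (K : R) : (forall th : R, - r <= th <= 0 -> `|phi th| <= K) ->
  supnorm r phi <= K.
Proof.
move=> H; apply: ge_sup.
  by exists `|phi 0|, 0 => //=; rewrite in_itv/= lexx andbT oppr_le0 ltW.
by move=> _ [x /= + <-]; rewrite in_itv/=; exact: H.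
Qed.

Lemma supnorm_ge0 phi : inC r phi -> 0 <= supnorm r phi.
Proof.
move=> cphi; apply: le_trans (normr_ge0 (phi 0)) (supnorm_ub cphi _).
by rewrite lexx andbT oppr_le0 ltW.
Qed.

Lemma inCB phi psi : inC r phi -> inC r psi -> inC r (phi \- psi).
Proof. by move=> /cont_onP c1 /cont_onP c2; apply/cont_onP; exact: cont_onB. Qed.

End SupNorm.

(** [e1] is chosen first because it fixes the modulus of [B] along the reference solution, which in
    turn restricts [d]; hence [c] is only produced after [d]. *)
Lemma dependence_constants (R : realType) (E Q L sig0 e : R) :
  0 < sig0 -> 1 <= E -> 1 <= Q -> 0 < L -> 0 < e ->
  exists2 e1 : R, 0 < e1 & exists2 d2 : R, 0 < d2 & forall d : R, 0 < d -> d <= d2 ->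
    exists c : R, [/\ 0 <= c, d <= e, 2 * c * Q <= e &
      forall x : R, x <= sig0 -> E * d + E * (L * d + e1) * x <= c].
Proof.
move=> sig00 E1 Q1 L0 e0.
have E0 : 0 < E by lra.
have Q0 : 0 < Q by lra.
(* With [c] as below, [2 * c * Q] is [d * N2 / 2] plus at most [e1 * N1 / 2], and each of them is at
   most [e / 2]. *)
pose N1 := 4 * E * Q * (sig0 + 1).
have N10 : 0 < N1 by rewrite !mulr_gt0//; lra.
pose N2 := 4 * E * Q * (1 + L * sig0).
have Ls0 : 0 < L * sig0 by rewrite mulr_gt0.
have N20 : 0 < N2 by rewrite !mulr_gt0//; lra.
have [e1 e10 e1E] : exists2 e1 : R, 0 < e1 & e1 * N1 = e.
  by exists (e / N1); [rewrite divr_gt0|rewrite divfK// gt_eqF].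
have [d2 d20 d2E] : exists2 d : R, 0 < d & d * N2 = e.
  by exists (e / N2); [rewrite divr_gt0|rewrite divfK// gt_eqF].
exists e1 => //; exists d2 => // d d0 dd2.
have dN2 : d * N2 <= e by rewrite -d2E ler_wpM2r// ltW.
have Ed : 0 < E * d by rewrite mulr_gt0.
have q0 : 0 < E * (L * d + e1) by rewrite mulr_gt0// addr_gt0// mulr_gt0.
pose c := E * d + E * (L * d + e1) * sig0.
have c0 : 0 < c by rewrite addr_gt0// mulr_gt0.
have cQ : 2 * c * Q <= e.
  have := ltW (mulr_gt0 (mulr_gt0 E0 Q0) e10).
  move: e1E dN2; rewrite /N1 /N2 /c; lra.
exists c; split=> //; first exact: ltW.
  have h1 : d <= E * d by rewrite ler_peMl// ltW.
  have h2 : c <= c * Q by rewrite ler_peMr// ltW.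
  have h3 : 0 < E * (L * d + e1) * sig0 by rewrite mulr_gt0.
  move: c0 cQ h2; rewrite mulrAC -mulrA; rewrite {1 3}/c => h4 h5 h6; lra.
by move=> x xs; rewrite /c lerD2l ler_wpM2l// ltW.
Qed.

(** * Well-posedness under a Lipschitz condition between states with shared history *)

Section Evolution.
Context {R : realType} {X : completeNormedModType R} (S : R -> X -> X) (omega : R).
Context (S0 : forall x, S 0 x = x)
  (SD : forall (t s : R) x, 0 <= t -> 0 <= s -> S (t + s) x = S t (S s x))
  (Slin : forall t : R, 0 <= t ->
     forall (c : R) (x y : X), S t (c *: x + y) = c *: S t x + S t y)
  (Snorm : forall (t : R) x, 0 <= t -> `|S t x| <= expR (omega * t) * `|x|)
  (Scont : forall x, {within `[0, +oo[, continuous (fun t => S t x)}).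
Context (r a sig0 : R) (r0 : 0 < r) (sig00 : 0 < sig0) (B : R -> (R -> X) -> X).
(* Lipschitz continuity is only available between states sharing the part of the
   history that precedes the initial time. *)
Context
  (Bcont : forall (t : R) psi, a <= t -> inC r psi -> forall e : R, 0 < e ->
     exists2 d : R, 0 < d & forall (s : R) psi', a <= s -> inC r psi' ->
       `|s - t| < d -> (forall th : R, - r <= th <= 0 -> `|psi' th - psi th| <= d) ->
       `|B s psi' - B t psi| < e)
  (Blip : forall K : R, exists2 L : R, 0 < L & forall (t : R) psi1 psi2,
     a <= t <= a + sig0 -> inC r psi1 -> inC r psi2 ->
     (forall th : R, - r <= th <= 0 -> `|psi1 th| <= K) ->
     (forall th : R, - r <= th <= 0 -> `|psi2 th| <= K) ->
     (forall th : R, - r <= th <= a - t -> psi1 th = psi2 th) ->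
     forall m : R, 0 <= m -> (forall th : R, - r <= th <= 0 -> `|psi1 th - psi2 th| <= m) ->
     `|B t psi1 - B t psi2| <= L * m)
  (Bbd : forall K : R, exists2 C : R, 0 < C & forall (t : R) psi,
     a <= t <= a + sig0 -> inC r psi ->
     (forall th : R, - r <= th <= 0 -> `|psi th| <= K) -> `|B t psi| <= C).

Implicit Types (u v phi psi : R -> X).

Lemma segE u (s th : R) : - r <= th <= 0 -> seg r u s th = u (s + th).
Proof. by move=> h; rewrite /seg -/(clamp (- r) 0 th) clamp_id. Qed.

Lemma seg_inC u (T s : R) : cont_on (a - r) T u -> a <= s <= T -> inC r (seg r u s).
Proof.
move=> cu As; apply/cont_onP.
apply: (@cont_on_comp _ _ (a - r) T _ _ (fun th => s + clamp (- r) 0 th) u) => //.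
  move=> x Ax; rewrite clamp_id//; lra.
move=> x y; rewrite opprD addrACA subrr add0r; exact: clamp_lip.
Qed.

Lemma seg_unif u T : cont_on (a - r) T u -> forall e : R, 0 < e ->
  exists2 d : R, 0 < d & forall s s', a <= s <= T -> a <= s' <= T -> `|s - s'| < d ->
    forall th : R, - r <= th <= 0 -> `|seg r u s th - seg r u s' th| < e.
Proof.
move=> cu e e0; have [d d0 H] := cont_on_uniform cu e0; exists d => //.
move=> s s' As As' ss' th Ath; rewrite !segE//; apply: H; [lra|lra|].
by rewrite opprD addrACA subrr addr0.
Qed.

Definition forcing u s : X := B s (seg r u s).

Lemma forcing_cont u T : cont_on (a - r) T u -> cont_on a T (forcing u).
Proof.
move=> cu s As e e0.
have sa : a <= s by case/andP: As.
have [d d0 H] := Bcont sa (seg_inC cu As) e0.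
have [d1 d10 H1] := seg_unif cu d0.
exists (Num.min d d1); first by rewrite lt_min d0.
move=> z Az; rewrite lt_min => /andP[z1 z2]; apply: H => //.
- by case/andP: Az.
- exact: seg_inC Az.
- by move=> th Ath; apply/ltW/H1.
Qed.

Lemma mild_onP T phi u : mild_on r a T S B phi u <->
  [/\ cont_on (a - r) T u, forall th : R, - r <= th <= 0 -> u (a + th) = phi th &
      forall t, a <= t <= T -> u t = S (t - a) (phi 0) + duhamel S a (forcing u) t].
Proof.
have dis t v : cont_on (a - r) T v -> a <= t <= T ->
    is_RSint (fun s => S (t - s) (B s (seg r v s))) id a t (duhamel S a (forcing v) t).
  move=> cv /andP[a_t tT]; apply: (duhamel_is Slin Snorm Scont a_t).
  by apply: cont_on_sub (forcing_cont cv).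
split=> [[/cont_onP cu [hu eu]]|[cu hu eu]].
  split=> // t At; have /andP[a_t _] := At.
  by have := RS_unique a_t (dis _ _ cu At) (eu t At) => ->; rewrite addrC subrK.
split; first exact/cont_onP.
split=> // t At; rewrite (eu t At) addrAC subrr add0r; exact: dis.
Qed.

Lemma mild_on_sub T T' phi u : T' <= T -> mild_on r a T S B phi u ->
  mild_on r a T' S B phi u.
Proof.
move=> TT' /mild_onP[cu hu eu]; apply/mild_onP; split=> //.
  exact: cont_on_sub cu.
by move=> t At; apply: eu; lra.
Qed.

Lemma shift_in (T s th : R) : a <= s <= T -> - r <= th <= 0 -> a - r <= s + th <= T.
Proof. lra. Qed.

Lemma widen_in (T t : R) : a <= t <= T -> a - r <= t <= T.
Proof. by have := r0; lra. Qed.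

Lemma back_in (T s : R) : a - r <= s <= T -> (a - r <= s <= a) \/ (a <= s <= T).
Proof. by have [le|lt] := leP s a => As; [left|right]; lra. Qed.

Lemma sub_in (s : R) : a - r <= s <= a -> - r <= s - a <= 0.
Proof. lra. Qed.

Lemma trans_in (T T' s : R) : a <= T <= T' -> a <= s <= T -> a <= s <= T'.
Proof. lra. Qed.

Lemma old_in (T s th : R) : a <= s <= T -> - r <= th <= a - s ->
  - r <= th <= 0 /\ a - r <= s + th <= a.
Proof. by move=> As Ath; split; lra. Qed.

Lemma dist_in (T s sig : R) : a <= T <= a + sig -> a <= s <= T ->
  0 <= s - a <= sig /\ T - a <= sig.
Proof. by move=> AT As; split; lra. Qed.

(** [phi (hist s)] extends the initial function to all times by its end values. *)
Let hist (s : R) : R := clamp (- r) 0 (s - a).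

Let hist_in s : - r <= hist s <= 0.
Proof. by apply: clamp_in; rewrite oppr_le0 ltW. Qed.

Let hist_cont phi lo hi : inC r phi -> cont_on lo hi (fun s => phi (hist s)).
Proof.
move=> /cont_onP cphi; apply: cont_on_comp cphi => // x y.
apply: le_trans (clamp_lip _ _ _ _) _.
by rewrite (_ : x - a - (y - a) = x - y)//; ring.
Qed.

(** The states compared with the segments of [u] need not share their history, so only continuity of
    [B] is available; compactness of the time interval makes it uniform along [u]. *)
Lemma forcing_unif u T : cont_on (a - r) T u -> forall e1 : R, 0 < e1 ->
  exists2 d : R, 0 < d & forall s : R, a <= s <= T -> forall psi, inC r psi ->
    (forall th : R, - r <= th <= 0 -> `|psi th - seg r u s th| <= d) ->
    `|B s psi - forcing u s| <= e1.
Proof.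
move=> cu e1 e10.
apply: (@itv_uniform R a T (fun d s => forall psi, inC r psi ->
    (forall th : R, - r <= th <= 0 -> `|psi th - seg r u s th| <= d) ->
    `|B s psi - forcing u s| <= e1)).
move=> s As; have sa : a <= s by case/andP: As.
have e120 : 0 < e1 / 2 by rewrite divr_gt0.
have [dB dB0 HB] := Bcont sa (seg_inC cu As) e120.
have dB20 : 0 < dB / 2 by rewrite divr_gt0.
have [dS dS0 HS] := seg_unif cu dB20.
exists (Num.min (dB / 2) dS); first by rewrite lt_min dB20.
move=> z Az; rewrite lt_min => /andP[z1 z2] k k0; rewrite lt_min => /andP[k1 k2].
move=> psi cpsi psiu; have za : a <= z by case/andP: Az.
have zs : `|z - s| < dB by lra.
have h1 : `|B z psi - forcing u s| < e1 / 2.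
  apply: HB => // th Ath; have b1 := HS _ _ Az As z2 th Ath; have b2 := psiu th Ath.
  have := ler_distD (seg r u z th) (psi th) (seg r u s th); lra.
have h2 : `|forcing u z - forcing u s| < e1 / 2.
  apply: HB => //; first exact: seg_inC cu Az.
  by move=> th Ath; have := HS _ _ Az As z2 th Ath; lra.
have := ler_distD (forcing u s) (B z psi) (forcing u z).
rewrite (distrC (forcing u s)); lra.
Qed.

(* The comparison state [v] carries the history of [phi'] and the increments of
   [u]; Gronwall's argument is run with the weight [expR (lam * (t - a))]. *)
Lemma mild_dependence (T : R) phi u (K : R) : inC r phi -> a <= T <= a + sig0 ->
  mild_on r a T S B phi u -> forall e : R, 0 < e -> exists2 d : R, 0 < d &
  forall phi' u', inC r phi' ->
    (forall th : R, - r <= th <= 0 -> `|phi' th - phi th| <= d) ->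
    mild_on r a T S B phi' u' -> (forall s : R, a - r <= s <= T -> `|u' s| <= K) ->
    forall s : R, a - r <= s <= T -> `|u' s - u s| <= e.
Proof.
move=> cphi AT /mild_onP[cu hu eu] e e0.
have [Ku Ku0 uK] := cont_on_bounded cu.
(* [Kb] bounds [u'] and also every function within distance [1] of [u], such as the comparison
   state. *)
pose Kb := `|K| + Ku + 1; have [L L0 HL] := Blip Kb.
have KKb : K <= Kb by have := ler_norm K; rewrite /Kb; lra.
have uKb (x y : X) : `|x| <= Ku -> `|y - x| <= 1 -> `|y| <= Kb.
  have := ler_distD x y (0 : X); have := normr_ge0 K.
  by rewrite !subr0 /Kb; lra.
have uDK s : a <= s <= T -> forall u' : R -> X,
    (forall s : R, a - r <= s <= T -> `|u' s| <= K) -> `|u' s - u s| <= `|K| + Ku.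
  move=> As u' uK'; apply: le_trans (ler_normB _ _) _; apply: lerD.
    by apply: le_trans (ler_norm K); apply: uK'; exact: widen_in.
  by apply: uK; exact: widen_in.
move: Kb KKb uKb HL => Kb KKb uKb HL.
pose E := sgbound omega sig0.
have E1 : 1 <= E by exact/sgbound_ge1/ltW.
have E0 : 0 < E by exact: sgbound_gt0.
(* This choice makes the contraction factor [E * L / lam] equal to one half, as [weighted_gap]
   requires. *)
pose lam := 2 * E * L; have l0 : 0 < lam by rewrite !mulr_gt0.
have lamE : E * L / lam = 2^-1 by rewrite /lam; field; rewrite !gt_eqF.
pose w t := expR (lam * (t - a)).
have w_ge0 t : 0 <= w t by exact: expR_ge0.
have w_mono s t : s <= t -> w s <= w t.
  by move=> st; rewrite ler_expR ler_wpM2l ?(ltW l0)// lerB.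
have w1 t : a <= t -> 1 <= w t.
  by move=> a_t; rewrite -expR0 ler_expR mulr_ge0 ?subr_ge0// ltW.
pose Q := w (a + sig0).
have Q1 : 1 <= Q by apply: w1; rewrite lerDl ltW.
have wQ t : t <= T -> w t <= Q.
  by case/andP: AT => _ TA tT; apply: w_mono; exact: le_trans TA.
have [e1 e10 [d2 d20 Hc]] := dependence_constants sig00 E1 Q1 L0 e0.
have [d1 d10 H1] := forcing_unif cu e10.
(* [d1] serves the modulus of [B] along [u], [1] the bound [Kb], and [d2] the final constants. *)
have [d [d0 dd1 dle1 dd2]] : exists d : R, [/\ 0 < d, d <= d1, d <= 1 & d <= d2].
  exists (Num.min d1 (Num.min 1 d2)).
  by rewrite !lt_min d10 ltr01 d20 !ge_min !lexx !orbT.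
have [c [c0 de cQ Hx]] := Hc d d0 dd2.
have q0 : 0 <= L * d + e1 := ltW (addr_gt0 (mulr_gt0 L0 d0) e10).
exists d => // phi' u' cphi' pp /mild_onP[cu' hu' eu'] uK'.
have [v [cv vu vu']] : exists v, [/\ cont_on (a - r) T v,
    forall s, `|v s - u s| <= d & forall s, a - r <= s <= a -> v s = u' s].
  exists (fun s => u s + (phi' (hist s) - phi (hist s))); split.
  - by apply: cont_onD => //; apply: cont_onB; exact: hist_cont.
  - by move=> s; rewrite addrAC subrr add0r; exact: pp.
  - move=> s As; have As' := sub_in As.
    rewrite /hist clamp_id//.
    have h : s = a + (s - a) by rewrite addrC subrK.
    by rewrite {1}h hu// addrC subrK -hu'// -h.
have fu (m s : R) : 0 <= m -> (forall t, a <= t <= T -> `|u' t - u t| <= m * w t) ->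
    a <= s <= T -> `|forcing u' s - forcing u s| <= (L * d + e1) + (L * m) * w s.
  move=> m0 Hm As; have mw0 : 0 <= m * w s by rewrite mulr_ge0.
  (* [u'] and [v] share their history, hence the Lipschitz bound; [v] and [u] need not, and [h2]
     compares them at the fixed cost [e1]. *)
  have h1 : `|forcing u' s - forcing v s| <= L * (m * w s + d).
    apply: HL.
    - exact: trans_in AT As.
    - exact: seg_inC cu' As.
    - exact: seg_inC cv As.
    - by move=> th Ath; rewrite segE//; apply: le_trans (uK' _ _) _ => //; exact: shift_in.
    - move=> th Ath; rewrite segE//; apply: uKb (le_trans (vu _) dle1).
      by apply: uK; exact: shift_in.
    - move=> th Ath; have [Ath' Ast] := old_in As Ath.
      by rewrite !segE// vu'.
    - by rewrite addr_ge0// ltW.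
    (* Before [a] the two states agree; afterwards the increasing weight carries the bound from time
       [s + th] to time [s]. *)
    - move=> th Ath; rewrite !segE//; have [Ast|Ast] := back_in (shift_in As Ath).
        by rewrite vu'// subrr normr0 addr_ge0// ltW.
      apply: le_trans (ler_distD (u (s + th)) _ _) _; apply: lerD.
        apply: le_trans (Hm _ Ast) _; rewrite ler_wpM2l//; apply: w_mono.
        by rewrite gerDl; case/andP: Ath.
      by rewrite distrC.
  have h2 : `|forcing v s - forcing u s| <= e1.
    apply: H1 => //; first exact: seg_inC cv As.
    by move=> th Ath; rewrite !segE//; apply: le_trans (vu _) _.
  apply: le_trans (ler_distD (forcing v s) _ _) _; apply: le_trans (lerD h1 h2) _.
  rewrite (_ : _ + e1 = L * d + e1 + L * m * w s)//; ring.
have big : forall t, a <= t <= T -> `|u' t - u t| <= 2 * c * w t.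
  apply: (@weighted_gap R a T (fun t => `|u' t - u t|) w c (`|K| + Ku)) => //.
  - by rewrite addr_ge0// ltW.
  - by move=> t /andP[a_t _]; exact: w1.
  - move=> t At; apply: (@le_trans _ _ (`|K| + Ku)); first exact: uDK.
    rewrite ler_peMr ?addr_ge0 ?(ltW Ku0)//; apply: w1; by case/andP: At.
  move=> m m0 Hm t At.
  have Lm0 : 0 <= L * m := mulr_ge0 (ltW L0) m0.
  have [ta Ts] := dist_in AT At; have /andP[ta0 ts] := ta.
  have D := duhamel_diff Slin Snorm Scont (forcing_cont cu') (forcing_cont cu)
    At Ts q0 Lm0 l0 (fun s => fu m s m0 Hm).
  have D2 : `|S (t - a) (phi' 0 - phi 0)| <= E * d.
    apply: le_trans (semigroup_norm_le Snorm (sig := sig0) _ _) _ => //.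
    by rewrite ler_wpM2l ?(ltW E0)//; apply: pp; rewrite lexx oppr_le0 ltW.
  rewrite (eu' t At) (eu t At) opprD addrACA -semigroupB//.
  apply: le_trans (ler_normD _ _) _; apply: le_trans (lerD D2 D) _.
  rewrite -/E -/(w t) mulrDr addrA; apply: lerD; first by rewrite mulrA; exact: Hx.
  by rewrite !mulrA (_ : E * L * m / lam = m / 2)// mulrAC lamE mulrC.
move=> s As; have [As'|As'] := back_in As.
  by rewrite -vu'//; apply: le_trans (vu _) _.
apply: le_trans (big s As') _; apply: le_trans cQ.
by apply: ler_wpM2l; [rewrite mulr_ge0|apply: wQ; case/andP: As'].
Qed.

Lemma local_existence (K : R) : 0 <= K -> exists2 sig : R, 0 < sig <= sig0 &
  forall phi, inC r phi -> (forall th : R, - r <= th <= 0 -> `|phi th| <= K) ->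
  exists2 u, mild_on r a (a + sig) S B phi u &
    forall s : R, a - r <= s <= a + sig -> `|u s| <= sgbound omega sig0 * K + 1.
Proof.
move=> K0; have rpos := r0; have sigpos := sig00.
pose E := sgbound omega sig0.
have E1 : 1 <= E by exact/sgbound_ge1/ltW.
have E0 : 0 < E by lra.
pose K' := E * K + 1.
have EK0 : 0 <= E * K := mulr_ge0 (ltW E0) K0.
have KEK : K <= E * K by exact: ler_peMl.
have KK' : K <= K' by rewrite /K'; lra.
have [C C0 HC] := Bbd K'; have [L L0 HL] := Blip K'.
have EC0 : 0 < E * C := mulr_gt0 E0 C0.
have EL0 : 0 < 2 * (E * L) by rewrite mulr_gt0// mulr_gt0.
(* [E * C * sig <= 1] keeps the iterates below [K' = E * K + 1], and [2 * (E * L) * sig <= 1] gives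
   the contraction factor one half. Both constants come from [K] alone. *)
pose sig := Num.min sig0 (Num.min (E * C)^-1 (2 * (E * L))^-1).
have sig_gt0 : 0 < sig by rewrite !lt_min sigpos !invr_gt0 EC0.
have sig_le : sig <= sig0 by rewrite /sig ge_min lexx.
have sigC : E * C * sig <= 1.
  by rewrite mulrC -ler_pdivlMr// mul1r /sig !ge_min lexx orbT.
have sigL : 2 * (E * L) * sig <= 1.
  by rewrite mulrC -ler_pdivlMr// mul1r /sig !ge_min lexx !orbT.
exists sig; first by rewrite sig_gt0.
move=> phi cphi phiK; pose T := a + sig.
have aT : a <= T by rewrite /T; lra.
(* One formula covers history and future: before [a], [pr] stops the clock and the last bracket is
   [phi 0]; after [a], [hist] is [0] and the first difference vanishes. No gluing at [a] is needed
   for continuity. *)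
pose pr s := clamp a T s.
pose Phi u s := phi (hist s) - phi 0 +
  (S (pr s - a) (phi 0) + duhamel S a (forcing u) (pr s)).
have Phil u s : a - r <= s <= a -> Phi u s = phi (s - a).
  move=> As; rewrite /Phi /pr clamp_lo//; last lra.
  rewrite (duhamel_at Slin Snorm Scont) subrr S0 addr0 subrK.
  by rewrite /hist clamp_id//; lra.
have Phir u s : a <= s <= T ->
    Phi u s = S (s - a) (phi 0) + duhamel S a (forcing u) s.
  move=> As; rewrite /Phi /pr clamp_id// /hist clamp_hi ?subrr ?add0r//; lra.
(* Prescribing the history in [Y] is what makes the Lipschitz bound on [B] applicable to any two
   candidates. *)
pose Y u := [/\ cont_on (a - r) T u, forall th : R, - r <= th <= 0 -> u (a + th) = phi th &
  forall s : R, a - r <= s <= T -> `|u s| <= K'].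
have hist_eq u v s th : Y u -> Y v -> a <= s -> - r <= th <= a - s ->
    u (s + th) = v (s + th).
  move=> [_ hu _] [_ hv _] a_s Ath.
  rewrite (_ : s + th = a + (s + th - a)); last by ring.
  by rewrite hu ?hv//; lra.
have [||||||u [cu hu uK] Pu] := @uniform_fixpoint R X (a - r) T Y Phi
    (fun s => phi (hist s)) (2 * K').
- split.
  + exact: hist_cont.
  + move=> th Ath; rewrite /hist (_ : a + th - a = th) ?clamp_id//; ring.
  + by move=> s _; apply: le_trans (phiK _ (hist_in s)) _.
- move=> u Yu; have [cu hu uK] := Yu; have fc := forcing_cont cu.
  have prc (f : R -> X) : cont_on a T f -> cont_on (a - r) T (fun s => f (pr s)).
    by apply: cont_on_comp => [x _|x y]; [exact: clamp_in|exact: clamp_lip].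
  split.
  + apply: cont_onD; first by apply: cont_onB; [exact: hist_cont|exact: cont_on_cst].
    apply: (cont_onD (f := fun s => S (pr s - a) (phi 0))); last first.
      exact: prc (duhamel_cont S0 SD Slin Snorm Scont fc).
    apply: (prc (fun s => S (s - a) (phi 0))) => s As e e0.
    have sa0 : 0 <= s - a by lra.
    have [d d0 H] := semigroup_cont Scont (phi 0) sa0 e0.
    exists d => // z Az zs; apply: H; first by lra.
    by rewrite (_ : z - a - (s - a) = z - s)//; ring.
  + move=> th Ath; rewrite Phil; last lra.
    by rewrite (_ : a + th - a = th)//; ring.
  + move=> s As; have [le|lt] := leP s a.
      rewrite Phil; last lra.
      by apply: le_trans (phiK _ _) _ => //; lra.
    have As' : a <= s <= T by lra.
    rewrite Phir//; apply: le_trans (ler_normD _ _) _; apply: lerD.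
      apply: le_trans (semigroup_norm_le Snorm (sig := sig0) _ _) _.
        by rewrite /T in As'; lra.
      by rewrite ler_wpM2l ?(ltW E0)//; apply: phiK; lra.
    have Ts : T - a <= sig0 by rewrite /T; lra.
    apply: le_trans (duhamel_bound Slin Snorm Scont fc As' Ts (ltW C0) _) _.
      move=> z Az; apply: HC; first by rewrite /T in Az; lra.
        exact: seg_inC Az.
      by move=> th Ath; rewrite segE//; apply: uK; lra.
    apply: le_trans sigC; rewrite mulrA; apply: ler_wpM2l; first exact: ltW.
    by rewrite /T in As'; lra.
- move=> u v m Yu Yv m0 uv s As; have [cu hu uK] := Yu; have [cv hv vK] := Yv.
  have [le|lt] := leP s a.
    by rewrite !Phil ?subrr ?normr0 ?divr_ge0//; lra.
  have As' : a <= s <= T by lra.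
  rewrite !Phir// opprD addrACA subrr add0r.
  have Ts : T - a <= sig0 by rewrite /T; lra.
  have Lm0 : 0 <= L * m := mulr_ge0 (ltW L0) m0.
  (* The interval is short enough for the unweighted norm: [q = 0], with [lam = 1] as a
     placeholder. *)
  apply: le_trans (duhamel_diff Slin Snorm Scont (forcing_cont cu) (forcing_cont cv)
     As' Ts Lm0 (lexx 0) ltr01 _) _.
    move=> z Az; rewrite mul0r addr0; apply: HL => //.
    + by rewrite /T in Az; lra.
    + exact: seg_inC Az.
    + exact: seg_inC Az.
    + by move=> th Ath; rewrite segE//; apply: uK; lra.
    + by move=> th Ath; rewrite segE//; apply: vK; lra.
    + by move=> th Ath; rewrite !segE; [apply: hist_eq => //; lra|lra|lra].
    + by move=> th Ath; rewrite !segE//; apply: uv; lra.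
  rewrite !mul0r addr0 -/E.
  have h1 : s - a <= sig by rewrite /T in As'; lra.
  have h2 := ler_wpM2l (mulr_ge0 (ltW E0) Lm0) h1.
  have h3 := ler_wpM2r m0 sigL.
  lra.
- by rewrite mulr_ge0//; lra.
- move=> u v [_ _ uK] [_ _ vK] s As; apply: le_trans (ler_normB _ _) _.
  by have := uK s As; have := vK s As; lra.
- move=> u H; split.
  + apply: cont_on_unif_limit => e e0; have [v [cv _ _] vu] := H e e0.
    by exists v.
  + move=> th Ath; apply: small_norm_eq => e e0; have [v [_ hv _] vu] := H e e0.
    by rewrite distrC -hv//; apply: vu; rewrite /T; lra.
  + move=> s As; apply/ler_addgt0Pr => e e0; have [v [_ _ vK] vu] := H e e0.
    have := vu s As; have := vK s As; have := ler_distD (v s) (u s) 0.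
    by rewrite !subr0 (distrC (u s)); lra.
exists u => //; apply/mild_onP; split=> // t At.
by rewrite -Phir//; symmetry; apply: Pu; exact: widen_in.
Qed.

Lemma evolution_wellposed :
  exists (b : (R -> X) -> \bar R) (sol : (R -> X) -> R -> X),
    forall phi, inC r phi ->
      [/\ (a%:E < b phi)%E,
          mild_on_ab r a (b phi) S B phi (sol phi),
          (forall T v, a <= T -> (T%:E < b phi)%E -> mild_on r a T S B phi v ->
             forall s, a - r <= s <= T -> v s = sol phi s) &
          (forall phin : nat -> R -> X, (forall n, inC r (phin n)) ->
             (fun n => supnorm r (phin n \- phi)) @ \oo --> (0 : R) ->
             forall t, a <= t -> (t%:E < b phi)%E ->
               (\forall n \near \oo, (t%:E < b (phin n))%E) /\
               (fun n => supnorm r (seg r (sol (phin n)) t \- seg r (sol phi) t))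
                 @ \oo --> (0 : R))].
Proof.
have rpos := r0.
have /choice[sg Hsg] n : exists sig : R, 0 < sig <= sig0 /\
    forall phi, inC r phi -> (forall th : R, - r <= th <= 0 -> `|phi th| <= n%:R) ->
    exists2 u, mild_on r a (a + sig) S B phi u &
      forall s : R, a - r <= s <= a + sig -> `|u s| <= sgbound omega sig0 * n%:R + 1.
  by have [sig h1 h2] := local_existence (ler0n R n); exists sig.
(* A running minimum, so that a larger bound on the initial function never gives a longer
   lifetime. *)
pose sgm := fix F n : R := if n is m.+1 then Num.min (F m) (sg n) else sg 0%N.
have sgm_le n : sgm n <= sg n by case: n => //= n; rewrite ge_min lexx orbT.
have sgm_gt0 n : 0 < sgm n.
  elim: n => [|n IHn] /=; first by have [/andP[]] := Hsg 0%N.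
  by rewrite lt_min IHn; have [/andP[]] := Hsg n.+1.
have sgm_mono m n : (m <= n)%N -> sgm n <= sgm m.
  elim: n => [|n IHn]; first by rewrite leqn0 => /eqP->.
  rewrite leq_eqVlt => /predU1P[->//|mn]; apply: le_trans (IHn mn) => /=.
  by rewrite ge_min lexx.
have sgm0 n : sgm n <= sig0.
  by apply: le_trans (sgm_le n) _; have [/andP[]] := Hsg n.
(* Strictly above the norm: the gap lets all nearby initial functions have an index no larger than
   that of [phi]. *)
pose k phi := (Num.truncn (supnorm r phi)).+1.
have kP phi : inC r phi -> supnorm r phi < (k phi)%:R.
  by move=> cphi; rewrite /k -truncn_lt_nat// supnorm_ge0.
have k_le phi phi' : inC r phi -> inC r phi' -> supnorm r phi' < (k phi)%:R ->
    (k phi' <= k phi)%N.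
  by move=> c c'; rewrite -truncn_lt_nat// supnorm_ge0.
have /choice[sol Hsol] phi : exists u, inC r phi ->
    mild_on r a (a + sgm (k phi)) S B phi u /\
    forall s : R, a - r <= s <= a + sgm (k phi) ->
      `|u s| <= sgbound omega sig0 * (k phi)%:R + 1.
  have [cphi|nc] := pselect (inC r phi); last by exists (fun=> 0).
  have [_ H] := Hsg (k phi); have [|u mu uK] := H phi cphi.
    move=> th Ath; apply: le_trans (supnorm_ub cphi Ath) _; exact/ltW/kP.
  have le : a + sgm (k phi) <= a + sg (k phi) by rewrite lerD2l.
  exists u => _; split; first exact: mild_on_sub mu.
  by move=> s As; apply: uK; lra.
exists (fun phi => (a + sgm (k phi))%:E), sol => phi cphi.
have [ms sb] := Hsol phi cphi.
have s0 := sgm0 (k phi).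
split.
- by rewrite lte_fin ltrDl.
- move=> T aT; rewrite lte_fin => Tb; exact: mild_on_sub (ltW Tb) ms.
- move=> T v aT; rewrite lte_fin => Tb mv s As.
  have /mild_onP[cv _ _] := mv; have [K _ vK] := cont_on_bounded cv.
  have AT : a <= T <= a + sig0 by lra.
  (* Uniqueness is dependence with the same initial function; here the bound [K] may depend on the
     competitor [v]. *)
  apply: small_norm_eq => e e0; have e20 : 0 < e / 2 by rewrite divr_gt0.
  have [d d0 H] := mild_dependence K cphi AT (mild_on_sub (ltW Tb) ms) e20.
  apply: le_lt_trans (H phi v cphi _ mv vK s As) _; last by lra.
  by move=> th _; rewrite subrr normr0 ltW.
move=> phin cn cvg0 t a_t; rewrite lte_fin => tb.
have conv d : 0 < d -> \forall n \near \oo, supnorm r (phin n \- phi) < d.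
  move=> d0; move/cvgrPdist_lt: cvg0 => /(_ d d0).
  apply: filterS => n; rewrite sub0r normrN; apply: le_lt_trans; exact: ler_norm.
have kn : \forall n \near \oo, (k (phin n) <= k phi)%N.
  have gap : 0 < (k phi)%:R - supnorm r phi by rewrite subr_gt0 kP.
  apply: filterS (conv _ gap) => n h; apply: k_le => //.
  apply: (@le_lt_trans _ _ (supnorm r (phin n \- phi) + supnorm r phi)); last by lra.
  apply: supnorm_le => // th Ath.
  have h1 := supnorm_ub (inCB (cn n) cphi) Ath; have h2 := supnorm_ub cphi Ath.
  have := ler_normD ((phin n \- phi) th) (phi th); rewrite /= subrK; rewrite /= in h1; lra.
split.
  apply: filterS kn => n kn; rewrite lte_fin; apply: lt_le_trans tb _.
  by rewrite lerD2l; exact: sgm_mono.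
have AT : a <= t <= a + sig0 by lra.
apply/cvgrPdist_le => e e0.
(* The bound must not depend on [n]: local existence provides it, since the index of [phin n] is
   eventually at most that of [phi]. *)
have [d d0 H] := mild_dependence (sgbound omega sig0 * (k phi)%:R + 1) cphi AT
  (mild_on_sub (ltW tb) ms) e0.
near=> n.
have kn' : (k (phin n) <= k phi)%N by near: n; exact: kn.
have dn : supnorm r (phin n \- phi) < d by near: n; exact: conv.
have [mn nb] := Hsol (phin n) (cn n).
have tn : t <= a + sgm (k (phin n)).
  by have := sgm_mono _ _ kn'; lra.
have key s : a - r <= s <= t -> `|sol (phin n) s - sol phi s| <= e.
  apply: (H (phin n)) => //.
  - by move=> th Ath; apply: le_trans (ltW dn); exact: (supnorm_ub (inCB (cn n) cphi)).
  - exact: mild_on_sub mn.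
  - move=> z Az; apply: le_trans (nb z _) _; first by lra.
    by rewrite lerD2r ler_wpM2l ?ler_nat// ltW// sgbound_gt0.
have le : supnorm r (seg r (sol (phin n)) t \- seg r (sol phi) t) <= e.
  by apply: supnorm_le => // th Ath; rewrite /= !segE//; apply: key; lra.
have At : a <= t <= t by lra.
have ge : 0 <= supnorm r (seg r (sol (phin n)) t \- seg r (sol phi) t).
  have [/mild_onP[c1 _ _] /mild_onP[c2 _ _]] := (mild_on_sub tn mn, mild_on_sub (ltW tb) ms).
  by apply: supnorm_ge0 => //; apply: inCB; [exact: seg_inC c1 At|exact: seg_inC c2 At].
by rewrite sub0r normrN ger0_norm.
Unshelve. all: by end_near.
Qed.

End Evolution.

(** * The Stieltjes nonlinearity *)

Section Nonlinearity.
Context {R : realType} {X : completeNormedModType R} (r a : R) (r0 : 0 < r).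
Context (g gd : R -> R -> (R -> X) -> R) (eta h : nat -> R -> (R -> X) -> R)
  (p : R -> X -> X) (M_Vg L_Vgc L_p C1 C2 : R).
Context
  (gV : forall (t : R) (phi : R -> X), inC r phi ->
     (total_variation (- r) 0 (fun th => g th t phi) <= M_Vg%:E)%E)
  (gJ : forall (t : R) (phi : R -> X), inC r phi ->
     is_jump_part r (fun th => gd th t phi) (fun k => eta k t phi) (fun k => h k t phi))
  (etar : forall k (t : R) (phi : R -> X), inC r phi -> 0 <= eta k t phi <= r)
  (etac : forall k, contRC r (eta k)) (hc : forall k, contRC r (h k))
  (hsum : forall K : R, forall eps : R, 0 < eps -> exists N : nat,
     forall n m : nat, (N <= n)%N -> forall (t : R) (phi : R -> X), inC r phi ->
       `|t| <= K -> supnorm r phi <= K ->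
       \sum_(n <= k < m) `|h k t phi| <= eps)
  (LV0 : 0 <= L_Vgc)
  (gcV : forall (t1 t2 : R) (phi psi : R -> X), a <= t1 -> a <= t2 ->
     inC r phi -> inC r psi ->
     (total_variation (- r) 0
        (fun th => (g th t1 phi - gd th t1 phi) - (g th t2 psi - gd th t2 psi))%R
      <= (L_Vgc * (`|t1 - t2| + supnorm r (phi \- psi)))%:E)%E)
  (Lp0 : 0 <= L_p)
  (pL : forall (t s : R) (u v : X), `|p t u - p s v| <= L_p * (`|s - t| + `|u - v|))
  (C10 : 0 <= C1) (C20 : 0 <= C2)
  (pB : forall (s : R) (u : X), `|p s u| <= C1 * `|u| + C2).
Implicit Types (t s : R) (phi psi : R -> X).

Definition stieltjes_delay t psi : X :=
  RSint (fun th => p t (psi th)) (fun th => g th t psi) (- r) 0.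

Let mr0 : - r <= 0. Proof. by rewrite oppr_le0 ltW. Qed.

Lemma integrand_cont t psi : inC r psi -> cont_on (- r) 0 (fun th => p t (psi th)).
Proof.
move=> /cont_onP cpsi x Ax e e0.
have L1 : 0 < L_p + 1 by have := Lp0; lra.
have e'0 : 0 < e / (L_p + 1) by rewrite divr_gt0.
have [d d0 H] := cpsi x Ax _ e'0; exists d => // y Ay yx.
apply: le_lt_trans (pL _ _ _ _) _; rewrite subrr normr0 add0r.
have := H y Ay yx; rewrite ltr_pdivlMr// mulrDr mulr1 mulrC => h1.
by apply: le_lt_trans h1; rewrite lerDl.
Qed.

Lemma variation_bound_ge0 t psi : inC r psi -> 0 <= M_Vg.
Proof.
move=> cpsi; rewrite -lee_fin; apply: le_trans (gV t cpsi).
exact: total_variation_ge0.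
Qed.

Lemma stieltjes_delay_is t psi : inC r psi ->
  is_RSint (fun th => p t (psi th)) (fun th => g th t psi) (- r) 0 (stieltjes_delay t psi).
Proof.
move=> cpsi; have [v gv _] := controls_total_variation mr0 (gV t cpsi).
exact: RSint_is mr0 (integrand_cont t cpsi) gv.
Qed.

Lemma growth_ge0 (K : R) : 0 <= K -> 0 <= C1 * K + C2.
Proof. by move=> K0; rewrite addr_ge0// mulr_ge0. Qed.

Lemma growth_le t psi (K : R) : (forall th : R, - r <= th <= 0 -> `|psi th| <= K) ->
  forall th : R, - r <= th <= 0 -> `|p t (psi th)| <= C1 * K + C2.
Proof.
by move=> psiK th Ath; apply: le_trans (pB _ _) _; rewrite lerD2r ler_wpM2l// psiK.
Qed.

Lemma stieltjes_delay_bound t psi (K : R) : inC r psi -> 0 <= K ->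
  (forall th : R, - r <= th <= 0 -> `|psi th| <= K) ->
  `|stieltjes_delay t psi| <= M_Vg * (C1 * K + C2).
Proof.
move=> cpsi K0 psiK; have [v gv vM] := controls_total_variation mr0 (gV t cpsi).
have P0 := growth_ge0 K0.
apply: le_trans (RS_bound (H := fun x => v x * (C1 * K + C2)) mr0
  (stieltjes_delay_is t cpsi) _) _.
  move=> x y lx xy yh; rewrite -mulrBl; apply: ler_pM => //; first exact: gv.
  by apply: growth_le psiK _ _; rewrite lx (le_trans xy yh).
by rewrite -mulrBl ler_wpM2r.
Qed.

Lemma summable_jumps t psi : inC r psi ->
  forall e : R, 0 < e -> exists N, tails_le (fun k => h k t psi) N e.
Proof.
move=> cpsi e e0.
have [N HN] := hsum (Num.max `|t| (supnorm r psi)) e0.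
by exists N => m; apply: HN => //; rewrite le_max lexx ?orbT.
Qed.

(** A single estimate for two uses: when times and jumps coincide the sum vanishes and, the tail
    being arbitrarily small, a Lipschitz bound remains; otherwise the sum is small by continuity. *)
Lemma stieltjes_delay_diff t1 t2 psi1 psi2 (m K e : R) N : a <= t1 -> a <= t2 ->
  inC r psi1 -> inC r psi2 -> 0 <= m -> 0 <= K ->
  (forall th : R, - r <= th <= 0 -> `|psi1 th - psi2 th| <= m) ->
  (forall th : R, - r <= th <= 0 -> `|psi2 th| <= K) ->
  tails_le (fun k => h k t1 psi1) N e -> tails_le (fun k => h k t2 psi2) N e ->
  `|stieltjes_delay t1 psi1 - stieltjes_delay t2 psi2| <=
    (M_Vg * L_p + L_Vgc * (C1 * K + C2)) * (`|t1 - t2| + m) +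
    \sum_(k < N) `|h k t1 psi1 *: p t2 (psi2 (- eta k t1 psi1)) -
                   h k t2 psi2 *: p t2 (psi2 (- eta k t2 psi2))| +
    2 * e * (C1 * K + C2).
Proof.
move=> at1 at2 c1 c2 m0 K0 psim psiK T1 T2.
have [v gv vM] := controls_total_variation mr0 (gV t1 c1).
have [w gw wW] := controls_total_variation mr0 (gcV at1 at2 c1 c2).
have wW' : w 0 - w (- r) <= L_Vgc * (`|t1 - t2| + m).
  apply: le_trans wW _; rewrite ler_wpM2l// lerD2l.
  by apply: supnorm_le => // th Ath; exact: psim.
have D0 : 0 <= L_p * (`|t1 - t2| + m) by rewrite mulr_ge0// addr_ge0.
have pD th : - r <= th <= 0 -> `|p t1 (psi1 th) - p t2 (psi2 th)| <= L_p * (`|t1 - t2| + m).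
  move=> Ath; apply: le_trans (pL _ _ _ _) _.
  by rewrite ler_wpM2l// distrC lerD2l; exact: psim.
have := RS_jump_diff r0 (stieltjes_delay_is t1 c1) (stieltjes_delay_is t2 c2)
  (integrand_cont t2 c2) gv vM gw wW' (gJ t1 c1) (gJ t2 c2)
  (fun k => etar k t1 c1) (fun k => etar k t2 c2) (summable_jumps t1 c1)
  (summable_jumps t2 c2) T1 T2 D0 pD (growth_ge0 K0) (growth_le t2 psiK).
move=> H; apply: le_trans H _.
rewrite !lerD2r mulrDl !mulrA lerD2l.
by rewrite -!mulrA [(_ + m) * _]mulrC.
Qed.

Lemma stieltjes_delay_lip t psi1 psi2 (m K : R) : a <= t ->
  inC r psi1 -> inC r psi2 -> 0 <= m -> 0 <= K ->
  (forall th : R, - r <= th <= 0 -> `|psi1 th - psi2 th| <= m) ->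
  (forall th : R, - r <= th <= 0 -> `|psi2 th| <= K) ->
  (forall k, eta k t psi1 = eta k t psi2 /\ h k t psi1 = h k t psi2) ->
  `|stieltjes_delay t psi1 - stieltjes_delay t psi2| <=
    (M_Vg * L_p + L_Vgc * (C1 * K + C2)) * m.
Proof.
move=> a_t c1 c2 m0 K0 psim psiK same; have P0 := growth_ge0 K0.
have P1 : 0 < 2 * (C1 * K + C2) + 1 by lra.
apply/ler_addgt0Pr => e e0.
have e'0 : 0 < e / (2 * (C1 * K + C2) + 1) by rewrite divr_gt0.
have [N T2] := summable_jumps t c2 e'0.
have T1 : tails_le (fun k => h k t psi1) N (e / (2 * (C1 * K + C2) + 1)).
  by move=> n; under eq_bigr do rewrite (proj2 (same _)); exact: T2.
apply: le_trans (stieltjes_delay_diff a_t a_t c1 c2 m0 K0 psim psiK T1 T2) _.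
rewrite subrr normr0 add0r big1 ?addr0; last first.
  by move=> k _; have [-> ->] := same k; rewrite subrr normr0.
rewrite lerD2l (mulrC 2) -mulrA mulrAC ler_pdivrMr// ler_wpM2l ?(ltW e0)//; lra.
Qed.

(** With [f] fixed, only the jumps and their locations move. Continuity of [f] at each location is
    used without any rate, and this is where the Lipschitz property is lost. *)
Lemma jump_terms_cont t psi (f : R -> X) N : inC r psi -> cont_on (- r) 0 f ->
  forall e : R, 0 < e -> exists2 d : R, 0 < d & forall s psi', inC r psi' ->
    `|s - t| < d -> supnorm r (psi' \- psi) < d ->
    \sum_(k < N) `|h k s psi' *: f (- eta k s psi') - h k t psi *: f (- eta k t psi)| < e.
Proof.
move=> cpsi cf; elim: N => [|N IHN] e e0.
  by exists 1 => // s psi' _ _ _; rewrite big_ord0.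
have e20 : 0 < e / 2 by rewrite divr_gt0.
have e40 : 0 < e / 4 by rewrite divr_gt0.
have [d1 d10 H1] := IHN _ e20.
have [K K0 fK] := cont_on_bounded cf.
have mem s phi : inC r phi -> - r <= - eta N s phi <= 0.
  by move=> cphi; have := etar N s cphi; lra.
pose n := `|h N t psi| + 1.
have n0 : 0 < n by rewrite ltr_wpDl.
have en0 : 0 < e / 4 / n by rewrite divr_gt0.
have [df df0 Hf] := cf _ (mem t psi cpsi) _ en0.
have [d2 d20 H2] := @etac N t psi cpsi _ df0.
have eK0 : 0 < Num.min 1 (e / 4 / K) by rewrite lt_min ltr01 divr_gt0.
have [d3 d30 H3] := @hc N t psi cpsi _ eK0.
exists (Num.min d1 (Num.min d2 d3)); first by rewrite !lt_min d10 d20.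
move=> s psi' c'; rewrite !lt_min => /and3P[s1 s2 s3] /and3P[q1 q2 q3].
rewrite big_ord_recr/=.
have b1 := H1 s psi' c' s1 q1; have b2 := H2 s psi' c' s2 q2.
have := H3 s psi' c' s3 q3; rewrite lt_min => /andP[b3 b4].
have b5 : `|f (- eta N s psi') - f (- eta N t psi)| < e / 4 / n.
  by apply: Hf; [exact: mem|rewrite opprK addrC distrC].
have b6 : `|h N s psi'| <= n.
  have := ler_distD (h N t psi) (h N s psi') 0; rewrite !subr0 /n; lra.
have -> : h N s psi' *: f (- eta N s psi') - h N t psi *: f (- eta N t psi) =
    h N s psi' *: (f (- eta N s psi') - f (- eta N t psi)) +
    (h N s psi' - h N t psi) *: f (- eta N t psi).
  by rewrite scalerBr scalerBl addrA subrK.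
have b7 : `|h N s psi' *: (f (- eta N s psi') - f (- eta N t psi))| <= e / 4.
  rewrite normrZ; apply: le_trans (ler_pM _ _ b6 (ltW b5)) _ => //.
  by rewrite mulrC divfK// gt_eqF.
have b8 : `|(h N s psi' - h N t psi) *: f (- eta N t psi)| <= e / 4.
  rewrite normrZ; apply: le_trans (ler_pM _ _ (ltW b4) (fK _ (mem t psi cpsi))) _ => //.
  by rewrite divfK// gt_eqF.
have b9 := ler_normD (h N s psi' *: (f (- eta N s psi') - f (- eta N t psi)))
   ((h N s psi' - h N t psi) *: f (- eta N t psi)).
rewrite (_ : e = e / 2 + (e / 4 + e / 4)); last by field.
by rewrite ltr_leD//; apply: le_trans b9 _; exact: lerD.
Qed.

Lemma stieltjes_delay_cont t psi : a <= t -> inC r psi -> forall e : R, 0 < e ->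
  exists2 d : R, 0 < d & forall s psi', a <= s -> inC r psi' -> `|s - t| < d ->
    (forall th : R, - r <= th <= 0 -> `|psi' th - psi th| <= d) ->
    `|stieltjes_delay s psi' - stieltjes_delay t psi| < e.
Proof.
move=> a_t cpsi e e0.
pose K := supnorm r psi; have K0 : 0 <= K by exact: supnorm_ge0.
have psiK th : - r <= th <= 0 -> `|psi th| <= K by exact: supnorm_ub.
pose P := C1 * K + C2; have P0 : 0 <= P := growth_ge0 K0.
pose Lam := M_Vg * L_p + L_Vgc * P.
have Lam0 : 0 <= Lam.
  by rewrite addr_ge0// mulr_ge0// (variation_bound_ge0 t cpsi).
have [e1 e10 e1P] : exists2 e1 : R, 0 < e1 & 2 * e1 * P <= e / 4.
  exists (e / 4 / (2 * (P + 1))); first by rewrite !divr_gt0// mulr_gt0//; lra.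
  rewrite (_ : _ * P = e / 4 * (P / (P + 1))); last by field; rewrite gt_eqF//; lra.
  rewrite -[leRHS]mulr1 ler_wpM2l//; first by lra.
  by rewrite ler_pdivrMr; lra.
(* [K1] bounds the times and norms of all states within distance [1], so one [N] cuts the tails for
   [psi] and its neighbours; [N] has to precede the radius given by [jump_terms_cont]. *)
pose K1 := `|t| + 1 + (K + 1).
have [N HN] := hsum K1 e10.
have T2 : tails_le (fun k => h k t psi) N e1.
  move=> m; apply: HN => //; rewrite -/K /K1; have := normr_ge0 t; lra.
have e40 : 0 < e / 4 by rewrite divr_gt0.
have [d1 d10 H1] := @jump_terms_cont t psi _ N cpsi (integrand_cont t cpsi) _ e40.
have [d2 d20 d2L] : exists2 d2 : R, 0 < d2 & Lam * (d2 + d2) <= e / 4.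
  exists (e / 4 / (2 * (Lam + 1))); first by rewrite !divr_gt0// mulr_gt0//; lra.
  rewrite (_ : Lam * _ = e / 4 * (Lam / (Lam + 1))); last by field; rewrite gt_eqF//; lra.
  rewrite -[leRHS]mulr1 ler_wpM2l//; first by lra.
  by rewrite ler_pdivrMr; lra.
pose d := Num.min (d1 / 2) (Num.min d2 1).
have d0 : 0 < d by rewrite !lt_min d20 ltr01 divr_gt0.
have dd1 : d <= d1 / 2 by rewrite /d ge_min lexx.
have dd2 : d <= d2 by rewrite /d !ge_min lexx orbT.
have dle1 : d <= 1 by rewrite /d !ge_min lexx !orbT.
exists d => // s psi' a_s c' st pp.
have sup_d : supnorm r (psi' \- psi) <= d by apply: supnorm_le => // th Ath; exact: pp.
have T1 : tails_le (fun k => h k s psi') N e1.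
  move=> m; apply: HN => //.
    have := ler_distD t s 0; rewrite !subr0 /K1; lra.
  apply: supnorm_le => // th Ath; have := pp th Ath; have := psiK th Ath.
  have := ler_distD (psi th) (psi' th) 0; have := normr_ge0 t.
  by rewrite !subr0 /K1; lra.
have st1 : `|s - t| < d1 by lra.
have sup1 : supnorm r (psi' \- psi) < d1 by lra.
have b1 := H1 s psi' c' st1 sup1.
have b2 := stieltjes_delay_diff a_s a_t c' cpsi (ltW d0) K0 pp psiK T1 T2.
apply: le_lt_trans b2 _; rewrite -/P -/Lam.
have b3 : Lam * (`|s - t| + d) <= e / 4.
  by apply: le_trans d2L; rewrite ler_wpM2l//; lra.
lra.
Qed.

End Nonlinearity.

(** * Estimates for the superposition map [G] *)

Section Superposition.
Context {R : realType} {X : completeNormedModType R} (a : R) (G : R -> X -> X -> X).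
Context (Gc : continuous (fun z : R * X * X => G z.1.1 z.1.2 z.2))
  (GL : forall Rad : R, 0 < Rad -> exists2 L : R, 0 < L &
     forall (t : R) (u1 u2 v1 v2 : X), a < t ->
       `|u1| <= Rad -> `|u2| <= Rad -> `|v1| <= Rad -> `|v2| <= Rad ->
       `|G t u1 v1 - G t u2 v2| <= L * (`|u1 - u2| + `|v1 - v2|)).

Lemma superposition_cont (t : R) (u v : X) (e : R) : 0 < e ->
  exists2 d : R, 0 < d & forall (s : R) (u' v' : X),
    `|s - t| < d -> `|u' - u| < d -> `|v' - v| < d -> `|G s u' v' - G t u v| < e.
Proof.
move=> e0; have /cvgrPdist_lt/(_ e e0) := @Gc (t, u, v).
move=> /nbhs_ballP[d /= d0 Hd]; exists d => // s u' v' h1 h2 h3.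
rewrite distrC; apply: (Hd (s, u', v')).
split; [split|] => /=; rewrite -ball_normE /= distrC//.
Qed.

(* The Lipschitz estimate passes to the limit [t -> a+]. *)
Lemma superposition_lip (Rad : R) : 0 < Rad -> exists2 L : R, 0 < L &
  forall (t : R) (u1 u2 v1 v2 : X), a <= t ->
    `|u1| <= Rad -> `|u2| <= Rad -> `|v1| <= Rad -> `|v2| <= Rad ->
    `|G t u1 v1 - G t u2 v2| <= L * (`|u1 - u2| + `|v1 - v2|).
Proof.
move=> Rad0; have [L L0 HL] := GL Rad0; exists L => // t u1 u2 v1 v2 a_t b1 b2 b3 b4.
apply/ler_addgt0Pr => e e0; have e20 : 0 < e / 2 by rewrite divr_gt0.
have [d1 d10 H1] := superposition_cont t u1 v1 e20.
have [d2 d20 H2] := superposition_cont t u2 v2 e20.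
pose d := Num.min d1 d2 / 2.
have m0 : 0 < Num.min d1 d2 by rewrite lt_min d10.
have d0 : 0 < d by rewrite divr_gt0.
have dm : d < Num.min d1 d2 by rewrite /d; lra.
move: dm; rewrite lt_min => /andP[dd1 dd2].
have n1 : `|t + d - t| = d by rewrite addrAC subrr add0r gtr0_norm.
have h1 : `|G (t + d) u1 v1 - G t u1 v1| < e / 2.
  by apply: H1; rewrite ?n1 ?subrr ?normr0.
have h2 : `|G (t + d) u2 v2 - G t u2 v2| < e / 2.
  by apply: H2; rewrite ?n1 ?subrr ?normr0.
have atd : a < t + d by lra.
have h3 := HL (t + d) u1 u2 v1 v2 atd b1 b2 b3 b4.
have h4 := ler_distD (G (t + d) u1 v1) (G t u1 v1) (G t u2 v2).
have h5 := ler_distD (G (t + d) u2 v2) (G (t + d) u1 v1) (G t u2 v2).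
rewrite (distrC (G t u1 v1) (G (t + d) u1 v1)) in h4; lra.
Qed.

(** Balls of [X] need not be compact, so continuity alone gives no bound: compactness is used in
    time only, for [G t 0 0], and the Lipschitz estimate covers the rest. *)
Lemma superposition_bound (hi Rad : R) : 0 < Rad -> exists2 C : R, 0 < C &
  forall (t : R) (u v : X), a <= t <= hi -> `|u| <= Rad -> `|v| <= Rad ->
    `|G t u v| <= C.
Proof.
move=> Rad0; have [L L0 HL] := superposition_lip Rad0.
have c0 : cont_on a hi (fun t => G t 0 0).
  move=> t _ e e0; have [d d0 H] := superposition_cont t 0 0 e0.
  by exists d => // s _ st; apply: H; rewrite ?subrr ?normr0.
have [K K0 GK] := cont_on_bounded c0.
have LR : 0 < L * (Rad + Rad) by rewrite mulr_gt0// addr_gt0.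
exists (K + L * (Rad + Rad)); first exact: addr_gt0.
move=> t u v At uR vR.
have h1 : `|G t u v - G t 0 0| <= L * (`|u - 0| + `|v - 0|).
  by apply: HL; rewrite ?normr0 ?(ltW Rad0)//; case/andP: At.
have h2 : L * (`|u - 0| + `|v - 0|) <= L * (Rad + Rad).
  by rewrite !subr0 ler_wpM2l ?(ltW L0)// lerD.
have h3 := GK t At; have h4 := ler_distD (G t 0 0) (G t u v) 0.
rewrite !subr0 in h4; lra.
Qed.

End Superposition.

(** Besides the convergence, the last clause records that [t] eventually lies below the lifetimes of
    the perturbed problems, which is what makes their segments at [t] meaningful. *)
Theorem theorem4 (R : realType) (X : completeNormedModType R)
  (r a omega : R) (S : R -> X -> X)
  (g : R -> R -> (R -> X) -> R) (gd : R -> R -> (R -> X) -> R)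
  (eta h : nat -> R -> (R -> X) -> R) (eta_ign : R -> R)
  (p : R -> X -> X) (G : R -> X -> X -> X)
  (M_Vg L_Vgc L_p C1 C2 : R) :
  0 < r ->
  (* {S t = e^{-At}} is a compact C0-semigroup with ||S t|| <= e^{omega t} *)
  (forall x, S 0 x = x) ->
  (forall t s x, 0 <= t -> 0 <= s -> S (t + s) x = S t (S s x)) ->
  (forall t, 0 <= t -> forall (c : R) (x y : X), S t (c *: x + y) = c *: S t x + S t y) ->
  (forall t x, 0 <= t -> `|S t x| <= expR (omega * t) * `|x|) ->
  (forall x, {within `[0, +oo[, continuous (fun t => S t x)}) ->
  (forall t, 0 < t -> compact (closure (S t @` [set x : X | `|x| <= 1]))) ->
  (* (A1) *)
  (forall t phi, inC r phi ->
     (total_variation (- r) 0 (fun th => g th t phi) <= M_Vg%:E)%E) ->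
  (* (A3): gd is the jump part of g, with jump points -eta_k and jumps h_k *)
  (forall t phi, inC r phi ->
     is_jump_part r (fun th => gd th t phi) (fun k => eta k t phi) (fun k => h k t phi)) ->
  (forall t phi, inC r phi ->
     {within `[- r, 0], continuous (fun th => g th t phi - gd th t phi)}) ->
  (forall k t phi, inC r phi -> 0 <= eta k t phi <= r) ->
  (forall k, contRC r (eta k)) ->
  (forall k, contRC r (h k)) ->
  (forall K : R, forall eps : R, 0 < eps -> exists N : nat,
     forall n m : nat, (N <= n)%N -> forall t phi, inC r phi ->
       `|t| <= K -> supnorm r phi <= K ->
       \sum_(n <= k < m) `|h k t phi| <= eps) ->
  (* (A2) *)
  (forall th, - r <= th <= 0 -> contRC r (fun t phi => g th t phi - gd th t phi)) ->
  (* (A4) *)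
  0 <= L_Vgc ->
  (forall t1 t2 phi psi, a <= t1 -> a <= t2 -> inC r phi -> inC r psi ->
     (total_variation (- r) 0
        (fun th => (g th t1 phi - gd th t1 phi) - (g th t2 psi - gd th t2 psi))%R
      <= (L_Vgc * (`|t1 - t2| + supnorm r (phi \- psi)))%:E)%E) ->
  (* (A5) *)
  {within `[a, +oo[, continuous eta_ign} ->
  (forall t, a <= t -> 0 < eta_ign t) ->
  (forall t phi1 phi2, a <= t -> inC r phi1 -> inC r phi2 ->
     (forall th, - r <= th <= - eta_ign t -> phi1 th = phi2 th) ->
     forall k, eta k t phi1 = eta k t phi2 /\ h k t phi1 = h k t phi2) ->
  (* hypotheses on p *)
  0 <= L_p ->
  (forall t s u v, `|p t u - p s v| <= L_p * (`|s - t| + `|u - v|)) ->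
  0 <= C1 -> 0 <= C2 ->
  (forall s u, `|p s u| <= C1 * `|u| + C2) ->
  (* hypotheses on G *)
  continuous (fun z : R * X * X => G z.1.1 z.1.2 z.2) ->
  (forall Rad : R, 0 < Rad -> exists2 L : R, 0 < L &
     forall t u1 u2 v1 v2, a < t ->
       `|u1| <= Rad -> `|u2| <= Rad -> `|v1| <= Rad -> `|v2| <= Rad ->
       `|G t u1 v1 - G t u2 v2| <= L * (`|u1 - u2| + `|v1 - v2|)) ->
  let F := fun t (psi : R -> X) =>
    RSint (fun th => p t (psi th)) (fun th => g th t psi) (- r) 0 in
  let B := fun t (psi : R -> X) => G t (psi 0) (F t psi) in
  exists (b : (R -> X) -> \bar R) (sol : (R -> X) -> R -> X),
    forall phi, inC r phi ->
      [/\ (a%:E < b phi)%E,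
          mild_on_ab r a (b phi) S B phi (sol phi),
          (forall T v, a <= T -> (T%:E < b phi)%E -> mild_on r a T S B phi v ->
             forall s, a - r <= s <= T -> v s = sol phi s) &
          (forall phin : nat -> R -> X, (forall n, inC r (phin n)) ->
             (fun n => supnorm r (phin n \- phi)) @ \oo --> (0 : R) ->
             forall t, a <= t -> (t%:E < b phi)%E ->
               (\forall n \near \oo, (t%:E < b (phin n))%E) /\
               (fun n => supnorm r (seg r (sol (phin n)) t \- seg r (sol phi) t))
                 @ \oo --> (0 : R))].
Proof.
move=> r0 S0 SD Slin Snorm Scont _ gV gJ _ etar etac hc hsum _ LV0 gcV ec epos eign.
move=> Lp0 pL C10 C20 pB Gc GL F B.
have Fcont (t : R) psi := stieltjes_delay_cont r0 gV gJ etar etac hc hsum LV0 gcV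
  Lp0 pL C10 C20 pB (t := t) (psi := psi).
have Fbd (t : R) psi (K : R) := stieltjes_delay_bound r0 gV Lp0 pL C10 C20 pB t
  (psi := psi) (K := K).
have Flip (t : R) psi1 psi2 (m K : R) := stieltjes_delay_lip r0 gV gJ etar hsum LV0 gcV
  Lp0 pL C10 C20 pB (t := t) (psi1 := psi1) (psi2 := psi2) (m := m) (K := K).
have z0 : - r <= 0 <= (0 : R) by rewrite lexx oppr_le0 ltW.
have [sig0 sig00 sigE] : exists2 sig0 : R, 0 < sig0 &
    forall t : R, a <= t <= a + sig0 -> t - a <= eta_ign t.
  have ea := epos a (lexx a).
  have e20 : 0 < eta_ign a / 2 by rewrite divr_gt0.
  move/within_continuousP: ec => ec.
  have [|d d0 Hd] := ec a _ _ e20; first by rewrite /= in_itv/= lexx.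
  (* On this interval [eta_ign] stays above half its value at [a], while [t - a] is at most that
     half. *)
  exists (Num.min (d / 2) (eta_ign a / 2)); first by rewrite lt_min e20 divr_gt0.
  move=> t /andP[a_t]; rewrite -lerBlDl le_min => /andP[t1 t2].
  have := Hd t; rewrite /= in_itv/= a_t => /(_ isT).
  have td : `|t - a| < d by rewrite ger0_norm ?subr_ge0//; lra.
  by move=> /(_ td); rewrite ltr_norml; lra.
apply: (evolution_wellposed S0 SD Slin Snorm Scont r0 sig00 (B := B)).
- move=> t psi a_t cpsi e e0.
  have [d d0 Hd] := superposition_cont Gc t (psi 0) (F t psi) e0.
  have [d1 d10 H1] := Fcont t psi a_t cpsi d d0.
  exists (Num.min (d / 2) d1); first by rewrite lt_min d10 divr_gt0.
  move=> s psi' a_s c'; rewrite lt_min => /andP[s1 s2] pp.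
  apply: Hd.
  + by lra.
  + apply: le_lt_trans (pp 0 z0) _; rewrite gt_min; apply/orP; left; lra.
  + apply: H1 => // th Ath; apply: le_trans (pp th Ath) _.
    by rewrite ge_min lexx orbT.
(* A negative [K] admits no state, so any constant will do. *)
- move=> K; have [K0|K0] := ltP K 0.
    exists 1 => // t psi1 psi2 _ _ _ b; have := b 0 z0.
    by have := normr_ge0 (psi1 0); lra.
  (* [Rad] bounds both arguments of [G]: the present value by [K], the delay integral by [P]. *)
  pose P := `|M_Vg * (C1 * K + C2)|; pose Rad := K + P + 1.
  have P0 : 0 <= P by exact: normr_ge0.
  have Rad0 : 0 < Rad by rewrite /Rad; lra.
  have [L L0 HL] := superposition_lip Gc GL Rad0.
  pose Lam := M_Vg * L_p + L_Vgc * (C1 * K + C2).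
  have LamA := ler_norm Lam.
  exists (L * (1 + `|Lam|)).
    by rewrite mulr_gt0//; have := normr_ge0 Lam; lra.
  move=> t psi1 psi2 At c1 c2 b1 b2 same m m0 pm; have /andP[a_t _] := At.
  have Frad psi : inC r psi -> (forall th : R, - r <= th <= 0 -> `|psi th| <= K) ->
      `|F t psi| <= Rad.
    move=> cpsi psiK; apply: le_trans (Fbd t psi K cpsi K0 psiK) _.
    by have := ler_norm (M_Vg * (C1 * K + C2)); rewrite -/P /Rad; lra.
  have Krad : K <= Rad by rewrite /Rad; lra.
  apply: le_trans (HL t _ _ _ _ a_t (le_trans (b1 0 z0) Krad) (le_trans (b2 0 z0) Krad)
    (Frad _ c1 b1) (Frad _ c2 b2)) _.
  rewrite -mulrA ler_wpM2l ?(ltW L0)// mulrDl mul1r; apply: lerD; first exact: pm.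
  apply: (@le_trans _ _ (Lam * m)); last by rewrite ler_wpM2r.
  (* Agreement on [[- r, a - t]] covers [[- r, - eta_ign t]], because [t - a <= eta_ign t]. *)
  apply: Flip => //; apply: eign => // th /andP[th1 th2]; apply: same.
  by have := sigE t At; lra.
- move=> K; have [K0|K0] := ltP K 0.
    exists 1 => // t psi _ _ b; have := b 0 z0.
    by have := normr_ge0 (psi 0); lra.
  pose P := `|M_Vg * (C1 * K + C2)|; pose Rad := K + P + 1.
  have P0 : 0 <= P by exact: normr_ge0.
  have Rad0 : 0 < Rad by rewrite /Rad; lra.
  have [C C0 HC] := superposition_bound Gc GL (a + sig0) Rad0.
  exists C => // t psi At cpsi psiK; apply: HC => //.
    by apply: le_trans (psiK 0 z0) _; rewrite /Rad; lra.
  apply: le_trans (Fbd t psi K cpsi K0 psiK) _.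
  by have := ler_norm (M_Vg * (C1 * K + C2)); rewrite -/P /Rad; lra.
Qed.
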